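(* Let $\mathbb{P}$ be the forcing poset whose conditions are triples $(a,x,A)$ satisfying: (1) $a$ is a finite subset of $\{\xi<\omega_2:\mathrm{cf}(\xi)=\omega\}$; (2) $x$ is a finite set of triples $\langle\alpha,\gamma,\beta\rangle$, where $\alpha\in\Gamma$ and $\gamma<\beta<\alpha$; (3) $A$ is a finite adequate set; (4) if $\langle\alpha,\gamma,\beta\rangle$ and $\langle\alpha,\gamma',\beta'\rangle$ are distinct triples in $x$, then $[\gamma,\beta)\cap[\gamma',\beta')=\emptyset$; (5) if $\xi\in a$, $M\in A$, $\sup(M\cap\xi)=\xi$, and $M\setminus\xi\neq\emptyset$, then $\xi\in M$; (6) whenever $M\in A$, $\alpha\in M$, and $\langle\alpha,\gamma,\beta\rangle\in x$: if $M\cap[\gamma,\beta]\neq\emptyset$ then $\gamma,\beta\in M$; and if $M\cap[\gamma,\beta]=\emptyset$ then $\sup(M\cap\alpha)<\gamma$; ordered by $(b,y,B)\le(a,x,A)$ iff $a\subseteq b$, $x\subseteq y$ and $A\subseteq B$. Then $\mathbb{P}$ is $\omega_2$-c.c.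
   Context: Standing assumptions and notation. Assume $2^{\omega_1}=\omega_2$ and fix a bijection $\pi:\omega_2\to H(\omega_2)$. $P_{\omega_1}(\omega_2)$ is the set of countable subsets of $\omega_2$. Assume there is a stationary set $\mathcal{Y}\subseteq P_{\omega_1}(\omega_2)$ which is thin, i.e. for all $\beta<\omega_2$ the set $\{a\cap\beta: a\in\mathcal{Y}\}$ has size at most $\omega_1$; fix such a $\mathcal{Y}$ which is moreover closed under initial segments ($a\in\mathcal{Y}$, $\beta<\omega_2$ imply $a\cap\beta\in\mathcal{Y}$). Let $\mathcal{A}$ be the structure $(H(\omega_2),\in,\pi,\mathcal{Y})$, which has definable Skolem functions (via the well-ordering induced by $\pi$). For $a\subseteq H(\omega_2)$, $Sk(a)$ is the closure of $a$ under a fixed set of definable Skolem functions for $\mathcal{A}$. Let $C$ be the (club) set of $\beta<\omega_2$ with $Sk(\beta)\cap\omega_2=\beta$, and let $\Lambda$ be the set of $\beta<\omega_2$ of cofinality $\omega_1$ which are limit points of $C$. Let $\mathcal{X}$ be the set of $M\in\mathcal{Y}$ such that $Sk(M)\cap\omega_2=M$ and for all $\gamma\in M$, $\sup(C\cap\gamma)\in M$. Comparison points and adequacy. Fix a set $\Gamma\subseteq\Lambda$ which is stationary in $\omega_2$. For $M\in\mathcal{X}$, $\Gamma_M$ is the set of $\beta\in\Gamma$ such that $\beta=\min(\Gamma\setminus\sup(M\cap\beta))$, i.e. $\Gamma\cap[\sup(M\cap\beta),\beta)=\emptyset$. For $M,N\in\mathcal{X}$, $\Gamma_M\cap\Gamma_N$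 has a largest element, denoted $\beta_{M,N}$. A set $A\subseteq\mathcal{X}$ is adequate if for all $M,N\in A$, either $M\cap\beta_{M,N}=N\cap\beta_{M,N}$, or $M\cap\beta_{M,N}\in Sk(N)$, or $N\cap\beta_{M,N}\in Sk(M)$. A poset is $\omega_2$-c.c. if every antichain has size less than $\omega_2$. *)

(* Defs.v *)
From HB Require Import structures.
From mathcomp Require Import all_boot.
From mathcomp Require Import boolp classical_sets functions cardinality.

Set Implicit Arguments.
Unset Strict Implicit.
Unset Printing Implicit Defensive.

Local Open Scope classical_set_scope.
Local Open Scope card_scope.

(** * The universe of sets

    [V] is the cumulative hierarchy: well-founded trees (Aczel) with arbitrary
    small branching, modulo bisimulation. Membership is well-founded and
    extensional for Leibniz equality; [set V] is the type of classes. *)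

Inductive tree : Type := Node (I : Type) (f : I -> tree).

Fixpoint bisim (s t : tree) : Prop :=
  let: Node A f := s in let: Node B g := t in
  (forall i, exists j, bisim (f i) (g j)) /\
  (forall j, exists i, bisim (f i) (g j)).

Definition V : Type := {c : set tree | exists t, c = bisim t}.

HB.instance Definition _ := gen_eqMixin V.
HB.instance Definition _ := gen_choiceMixin V.

Definition cls (t : tree) : V := exist _ (bisim t) (ex_intro _ t erefl).

Definition inV (x y : V) : Prop :=
  exists (I : Type) (f : I -> tree) (i : I), y = cls (Node f) /\ x = cls (f i).

(** The class of elements of a set. *)
Definition ext (x : V) : set V := [set y | inV y x].

Lemma bisim_refl t : bisim t t.
Proof. by elim: t => I f IH /=; split=> i; exists i. Qed.

Lemma bisim_sym s t : bisim s t -> bisim t s.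
Proof.
elim: s t => I f IH [J g] /= [h1 h2]; split=> [j|i].
  by have [i hi] := h2 j; exists i; apply: IH.
by have [j hj] := h1 i; exists j; apply: IH.
Qed.

Lemma bisim_trans s t u : bisim s t -> bisim t u -> bisim s u.
Proof.
elim: s t u => I f IH [J g] [K h] /= [a1 a2] [b1 b2]; split=> [i|k].
  by have [j hj] := a1 i; have [k hk] := b1 j; exists k; apply: IH hj hk.
by have [j hj] := b2 k; have [i hi] := a2 j; exists i; apply: IH hi hj.
Qed.

Lemma cls_eq s t : cls s = cls t <-> bisim s t.
Proof.
split=> [[]/(congr1 (fun c : set tree => c t)) e|st].
  by rewrite e; apply: bisim_refl.
apply: eq_exist; apply/funext => u; apply/propext.
by split; apply: bisim_trans => //; apply: bisim_sym.
Qed.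

Lemma clsP (x : V) : exists (I : Type) (f : I -> tree), x = cls (Node f).
Proof.
case: x => c [[I f] e]; exists I, f; exact: eq_exist.
Qed.

Lemma inV_Node I (f : I -> tree) x : inV x (cls (Node f)) <-> exists i, x = cls (f i).
Proof.
split=> [[J [g [j [/cls_eq/= [_ h] ->]]]]|[i ->]]; last by exists I, f, i.
by have [i hi] := h j; exists i; apply/cls_eq/bisim_sym.
Qed.

Lemma ext_inj : injective ext.
Proof.
move=> x y; have [I [f ->]] := clsP x; have [J [g ->]] := clsP y => e.
have E z : inV z (cls (Node f)) <-> inV z (cls (Node g)).
  by change (ext (cls (Node f)) z <-> ext (cls (Node g)) z); rewrite e.
apply/cls_eq; split=> [i|j].
  have /E/inV_Node[j /cls_eq hj] : inV (cls (f i)) (cls (Node f)).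
    by apply/inV_Node; exists i.
  by exists j.
have /E/inV_Node[i /cls_eq hi] : inV (cls (g j)) (cls (Node g)).
  by apply/inV_Node; exists j.
by exists i; apply: bisim_sym.
Qed.

Lemma inV_ind (P : V -> Prop) :
  (forall x, (forall y, inV y x -> P y) -> P x) -> forall x, P x.
Proof.
move=> H x; have [I [f ->]] := clsP x; move: (Node f) => t.
elim: t => I' f' IH; apply: H => y /inV_Node[i ->]; exact: IH.
Qed.

(** [setV A] is the set with extension [A] when the class [A] is a set (it is
    unique by [ext_inj]); on proper classes the value is irrelevant. *)
Definition emptyV : V := cls (@Node False (fun i => match i with end)).
Definition setV (A : set V) : V := xget emptyV [set x | ext x = A].

Lemma setVK (x : V) : setV (ext x) = x.
Proof.
apply: ext_inj.
exact: (xgetPex emptyV (ex_intro [set y | ext y = ext x] x erefl)).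
Qed.

Lemma ext_setV (x : V) (A : set V) : A `<=` ext x -> ext (setV A) = A.
Proof.
have [I [f ->]] := clsP x => Ax.
pose g (i : {i : I | A (cls (f i))}) := f (sval i).
suff e : ext (cls (Node g)) = A by rewrite -e setVK.
apply/seteqP; split=> z.
  by move=> /inV_Node[[i Ai] ->].
move=> Az; have /inV_Node[i zi] := Ax _ Az; apply/inV_Node.
have Ai : A (cls (f i)) by rewrite -zi.
by exists (exist _ i Ai).
Qed.

Lemma ext_setV_range (I : Type) (g : I -> V) : ext (setV (range g)) = range g.
Proof.
have [t gt] : {t : I -> tree & forall i, g i = cls (t i)}.
  apply: (@choice _ _ (fun i u => g i = cls u)) => i; have [J [h ->]] := clsP (g i); by exists (Node h).
apply: (@ext_setV (cls (Node t))) => z [i _ <-].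
by rewrite gt; apply/inV_Node; exists i.
Qed.

Definition interV (x y : V) : V := setV (ext x `&` ext y).

Lemma ext_interV x y : ext (interV x y) = ext x `&` ext y.
Proof. by apply: (@ext_setV x) => z []. Qed.

(** * Ordinals and cardinals *)

Definition transitive_class (A : set V) : Prop := forall y, A y -> ext y `<=` A.

(** von Neumann ordinals (well-foundedness of [inV] is [inV_ind]); the order is
    [inV]. *)
Definition ordinal_set (x : V) : Prop :=
  transitive_class (ext x) /\
  forall y z, inV y x -> inV z x -> [\/ inV y z, y = z | inV z y].

Definition ord_le (b c : V) : Prop := inV b c \/ b = c.

(** The intervals [b, c) and [b, c] for ordinals [b] and [c]. *)
Definition itv_co (b c : V) : set V :=
  [set d | ordinal_set d /\ ord_le b d /\ inV d c].
Definition itv_cc (b c : V) : set V :=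
  [set d | ordinal_set d /\ ord_le b d /\ ord_le d c].

(** The supremum of a set of ordinals is its union. *)
Definition supV (A : set V) : V := setV [set z | exists2 y, A y & inV z y].

Definition maxV (A : set V) : V :=
  xget emptyV [set b | A b /\ forall c, A c -> ord_le c b].

Definition card_lt {T U : Type} (A : set T) (B : set U) : Prop :=
  (A #<= B) /\ ~ (B #<= A).

Definition omega : set V := [set b | ordinal_set b /\ finite_set (ext b)].
Definition omega1 : set V := [set b | ordinal_set b /\ countable (ext b)].
Definition omega2 : set V := [set b | ordinal_set b /\ ext b #<= omega1].

Definition trcl (x : V) : set V := smallest transitive_class (ext x).
Definition H_omega2 : set V := [set x | card_lt (trcl x) omega2].

Definition cofinal_in (b : V) (X : set V) : Prop :=
  X `<=` ext b /\ forall c, inV c b -> exists2 d, X d & ord_le c d.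

(** cf(b) = kappa: the least cardinality of a cofinal subset of b is kappa. *)
Definition has_cof (b : V) (kappa : set V) : Prop :=
  (exists2 X, cofinal_in b X & X #= kappa) /\
  forall X, cofinal_in b X -> kappa #<= X.

Definition limit_point (A : set V) (b : V) : Prop :=
  b <> emptyV /\ supV (A `&` ext b) = b.

(** * Clubs and stationary sets *)

Definition club_omega2 (D : set V) : Prop :=
  [/\ D `<=` omega2,
      forall b, omega2 b -> exists2 d, D d & inV b d
    & forall b, omega2 b -> limit_point D b -> D b].

Definition stationary_omega2 (S : set V) : Prop :=
  S `<=` omega2 /\ forall D, club_omega2 D -> S `&` D !=set0.

(** P_{omega_1}(omega_2) *)
Definition Pctbl : set V := [set a | ext a `<=` omega2 /\ countable (ext a)].

Definition club_Pctbl (D : set V) : Prop :=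
  [/\ D `<=` Pctbl,
      forall a, Pctbl a -> exists2 d, D d & ext a `<=` ext d
    & forall u : nat -> V, (forall n, D (u n)) ->
        (forall n, ext (u n) `<=` ext (u n.+1)) ->
        D (setV (\bigcup_n ext (u n)))].

Definition stationary_Pctbl (S : set V) : Prop :=
  S `<=` Pctbl /\ forall D, club_Pctbl D -> S `&` D !=set0.

Definition thin (Y : set V) : Prop :=
  forall b, omega2 b -> [set interV a b | a in Y] #<= omega1.

Definition closed_initial (Y : set V) : Prop :=
  forall a b, Y a -> omega2 b -> Y (interV a b).

(** * The structure (H(omega_2), inV, pi, Y) and Skolem hulls *)

(** First-order formulas with free variables in ['I_n]; [Fex] binds variable 0. *)
Inductive formula : nat -> Type :=
| Feq n (i j : 'I_n) : formula n
| Fmem n (i j : 'I_n) : formula n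
| Fpi n (i j : 'I_n) : formula n
| FY n (i : 'I_n) : formula n
| Fnot n (phi : formula n) : formula n
| Fand n (phi psi : formula n) : formula n
| Fex n (phi : formula n.+1) : formula n.

Definition scons n (x : V) (v : 'I_n -> V) : 'I_n.+1 -> V :=
  fun i => if unlift ord0 i is Some j then v j else x.

(** Satisfaction in (H(omega_2), inV, pi, Y), with [pi] read as its graph. *)
Fixpoint sat (pi : V -> V) (Y : set V) n (phi : formula n) :
    ('I_n -> V) -> Prop :=
  match phi in formula n return ('I_n -> V) -> Prop with
  | Feq _ i j => fun v => v i = v j
  | Fmem _ i j => fun v => inV (v i) (v j)
  | Fpi _ i j => fun v => omega2 (v i) /\ pi (v i) = v j
  | FY _ i => fun v => Y (v i)
  | Fnot _ phi => fun v => ~ sat pi Y phi v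
  | Fand _ phi psi => fun v => sat pi Y phi v /\ sat pi Y psi v
  | Fex _ phi => fun v => exists2 x, H_omega2 x & sat pi Y phi (scons x v)
  end.

(** A finitary operation on H(omega_2); only its values on tuples from
    H(omega_2) matter. *)
Definition operation (n : nat) : Type := ('I_n -> V) -> V.

Definition tuple_in n (A : set V) (v : 'I_n -> V) : Prop := forall i, A (v i).

Definition definable_op pi Y n (f : operation n) : Prop :=
  exists phi : formula n.+1, forall v, tuple_in H_omega2 v ->
    H_omega2 (f v) /\
    forall x, H_omega2 x -> (sat pi Y phi (scons x v) <-> x = f v).

Definition skolem_for pi Y n (phi : formula n.+1) (f : operation n) : Prop :=
  forall v, tuple_in H_omega2 v -> sat pi Y (Fex phi) v ->
    sat pi Y phi (scons (f v) v).

(** [F] is a (full) set of definable Skolem functions for the structure. *)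
Definition definable_skolem pi Y (F : forall n, set (operation n)) : Prop :=
  (forall n (f : operation n), F n f -> definable_op pi Y f) /\
  forall n (phi : formula n.+1), exists2 f, F n f & skolem_for pi Y phi f.

Definition closed_under (F : forall n, set (operation n)) (B : set V) : Prop :=
  forall n (f : operation n) v, F n f -> tuple_in B v -> B (f v).

Definition Sk (F : forall n, set (operation n)) (A : set V) : set V :=
  smallest (closed_under F) A.

(** C, Lambda and the class X of models *)
Definition Cset F : set V :=
  [set b | omega2 b /\ Sk F (ext b) `&` omega2 = ext b].

Definition Lambda F : set V :=
  [set b | [/\ omega2 b, has_cof b omega1 & limit_point (Cset F) b]].

Definition Xset (Y : set V) F : set V :=
  [set M | [/\ Y M, Sk F (ext M) `&` omega2 = ext M
    & forall c, inV c M -> inV (supV (Cset F `&` ext c)) M]].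

(** * Comparison points and adequate sets *)

Definition Gamma_at (Gamma : set V) (M : V) : set V :=
  [set b | Gamma b /\ Gamma `&` itv_co (supV (ext (interV M b))) b = set0].

Definition comparison_pt (Gamma : set V) (M N : V) : V :=
  maxV (Gamma_at Gamma M `&` Gamma_at Gamma N).

Definition adequate Y F Gamma (A : set V) : Prop :=
  A `<=` Xset Y F /\
  forall M N, A M -> A N ->
    let b := comparison_pt Gamma M N in
    [\/ interV M b = interV N b,
        Sk F (ext N) (interV M b)
      | Sk F (ext M) (interV N b)].

(** * Posets and chain conditions *)

Definition compatible T (P : set T) (le : T -> T -> Prop) (p q : T) : Prop :=
  exists r, [/\ P r, le r p & le r q].

Definition antichain T (P : set T) (le : T -> T -> Prop) (W : set T) : Prop :=
  W `<=` P /\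
  forall p q, W p -> W q -> p <> q -> ~ compatible P le p q.

Definition chain_condition T (P : set T) (le : T -> T -> Prop) (kappa : set V)
    : Prop :=
  forall W, antichain P le W -> card_lt W kappa.

(** * The forcing poset *)

(** A triple [(alpha, gamma, beta)] is encoded as [((alpha, gamma), beta)],
    and a condition [(a, x, A)] as [((a, x), A)]. *)
Definition triple : Type := V * V * V.
Definition precond : Type := set V * set triple * set V.

Definition condition (Y : set V) F (Gamma : set V) : set precond :=
  [set p : precond | let: (a, x, A) := p in
   [/\ finite_set a /\ a `<=` [set xi | omega2 xi /\ has_cof xi omega],
       finite_set x /\
         (forall al g b, x (al, g, b) -> [/\ Gamma al, inV g b & inV b al]),
       finite_set A /\ adequate Y F Gamma A,
       (forall al g b g' b', x (al, g, b) -> x (al, g', b') ->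
         (al, g, b) <> (al, g', b') -> itv_co g b `&` itv_co g' b' = set0)
     & (forall xi M, a xi -> A M -> supV (ext (interV M xi)) = xi ->
         ext M `\` ext xi !=set0 -> inV xi M) /\
       (forall M al g b, A M -> inV al M -> x (al, g, b) ->
         (ext M `&` itv_cc g b !=set0 -> inV g M /\ inV b M) /\
         (ext M `&` itv_cc g b = set0 ->
           inV (supV (ext (interV M al))) g))]].

Definition condition_le (q p : precond) : Prop :=
  let: (b, y, B) := q in let: (a, x, A) := p in
  [/\ a `<=` b, x `<=` y & A `<=` B].

(* Main.v *)
(** Suppose the conditions [p_d], [d < omega_2], form an antichain. For [d] in
    [Gamma], which has cofinality [omega_1], the trace of [p_d] below [d] is
    bounded by some [c < d], and thinness leaves only [omega_1] possible traces
    for each [c]. Hence, choosing [d'] in [Gamma] inside a suitable club, there is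
    [d < d'] in [Gamma] with the same trace and with [p_d] lying below [d'], and
    the componentwise union of [p_d] and [p_d'] is again a condition.

    The delicate point is adequacy. If [M] is a model of [p_d] and [N] of [p_d'],
    then [N] agrees below [d'] with some model [K] of [p_d] below [d], and
    [b = beta_{M,N}] is at most [beta_{M,K}]. A countable set [P] in [Sk(K)] is
    included in [K], so [P] may be cut down to [b] by an element of [K]; and the
    index of [P] under [pi] is then below [b] since [Y] is thin and [b] lies in
    [Lambda], so it belongs to [N] as well as to [K]. *)

From HB Require Import structures.
Require Import Defs.
From mathcomp Require Import all_boot.
From mathcomp Require Import boolp classical_sets functions cardinality.

Set Implicit Arguments.
Unset Strict Implicit.
Unset Printing Implicit Defensive.

Local Open Scope classical_set_scope.
Local Open Scope card_scope.

HB.instance Definition _ := isPointed.Build V emptyV.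

(** * Injections, enumerations and comparison of cardinalities *)

Lemma inj_on_card_le T U (A : set T) (B : set U) (f : T -> U) :
  (forall x, A x -> B (f x)) ->
  (forall x y, A x -> A y -> f x = f y -> x = y) -> A #<= B.
Proof.
move=> fAB f_inj; have fA : f @` A #= A.
  by apply: inj_card_eq => x y /set_mem Ax /set_mem Ay; apply: f_inj.
by rewrite -(card_le_eql fA); apply: subset_card_le => _ [x Ax <-]; exact: fAB.
Qed.

Lemma card_le_inj_on T (U : pointedType) (A : set T) (B : set U) : A #<= B ->
  exists f : T -> U, (forall x, A x -> B (f x)) /\
    (forall x y, A x -> A y -> f x = f y -> x = y).
Proof.
move=> /pcard_leP[f]; exists f; split=> [x|x y Ax Ay]; first exact: funS.
by apply: inj; rewrite inE.
Qed.

Lemma countable_enum T (A : set T) (x0 : T) : A x0 -> countable A ->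
  exists f : nat -> T, (forall n, A (f n)) /\ forall x, A x -> exists n, x = f n.
Proof.
move=> Ax0 /card_le_inj_on[g [_ g_inj]].
(* [f n] is to be the preimage of [n] under [g]; for [n] without a preimage the default [x0]
   serves. *)
pose P n x := A x /\ ((exists2 y, A y & g y = n) -> g x = n).
have [f fP] : {f : nat -> T & forall n, P n (f n)}.
  apply: choice => n; have [[y Ay gy]|no] := pselect (exists2 y, A y & g y = n).
    by exists y.
  by exists x0.
exists f; split=> [n|x Ax]; first exact: (fP n).1.
exists (g x); apply: g_inj => //; first exact: (fP _).1.
by rewrite (fP (g x)).2 //; exists x.
Qed.

(* A maximal partial injection is total or surjective. *)
Lemma card_le_total T U (A : set T) (B : set U) : A #<= B \/ B #<= A.
Proof.
pose P (G : set (T * U)) := G `<=` A `*` B /\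
  forall p q, G p -> G q -> p.1 = q.1 \/ p.2 = q.2 -> p = q.
have [G [[GAB G_inj] Gmax]] : exists G, P G /\ forall H, G `<` H -> ~ P H.
  apply: Zorn_bigcup => C CP tot; split=> [p [G CG Gp]|p q [G CG Gp] [H CH Hq]].
    exact: (CP _ CG).1.
  by have [GH|HG] := tot _ _ CG CH;
    [apply: (CP _ CH).2 => //; exact: GH|apply: (CP _ CG).2 => //; exact: HG].
have [domG|/existsNP[a /not_implyP[Aa Ga]]] :=
    pselect (forall a, A a -> exists b, G (a, b)).
  left; have [->|/set0P[a0 Aa0]] := eqVneq A set0; first exact: card_ge0.
  have [b0 Gb0] := domG _ Aa0.
  have [f fP] : {f : T -> U & forall a, A a -> G (a, f a)}.
    apply: (@choice _ _ (fun a b => A a -> G (a, b))) => a.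
    by have [/domG[b Gb]|nA] := pselect (A a); [exists b|exists b0].
  apply: (@inj_on_card_le _ _ _ _ f) => [x /fP/GAB[]//|x y Ax Ay e].
  by have [] := G_inj _ _ (fP _ Ax) (fP _ Ay) (or_intror e).
have ranG b : B b -> exists a', G (a', b).
  move=> Bb; apply: contrapT => Gb.
  apply: (Gmax (G `|` [set (a, b)])).
    split; first by move=> x; left.
    by move=> /(_ (a, b)) Gab; apply: Ga; exists b; apply: Gab; right.
  split=> [p [/GAB//|->]//|p q [Gp|->] [Gq|->]//=]; first exact: G_inj.
    case: p Gp => p1 p2 /= Gp [e|e]; first by case: Ga; exists p2; rewrite -e.
    by case: Gb; exists p1; rewrite -e.
  case: q Gq => q1 q2 /= Gq [e|e]; first by case: Ga; exists q2; rewrite e.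
  by case: Gb; exists q1; rewrite e.
right; have [f fP] : {f : U -> T & forall b, B b -> G (f b, b)}.
  apply: (@choice _ _ (fun b a => B b -> G (a, b))) => b.
  by have [/ranG[a' Ga']|nB] := pselect (B b); [exists a'|exists a].
apply: (@inj_on_card_le _ _ _ _ f) => [x /fP/GAB[]//|x y Ax Ay e].
by have [] := G_inj _ _ (fP _ Ax) (fP _ Ay) (or_introl e).
Qed.

(** * Sets and ordinals *)

(** [T] may be as large as [V], so [A] cannot index a tree directly. The injection into [ext w]
    replaces it by the type [J] of those branches of a tree for [w] that are values of [h]. *)
Lemma replacement (T : Type) (A : set T) (g : T -> V) (w : V) :
  A #<= ext w -> exists x, ext x = g @` A.
Proof.
move=> /card_le_inj_on[h [hw h_inj]]; have [I [f ew]] := clsP w.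
pose J := {i : I | exists2 a, A a & h a = cls (f i)}.
have [k kP] : {k : J -> T & forall j, A (k j) /\ h (k j) = cls (f (sval j))}.
  apply: (@choice _ _ (fun (j : J) a => A a /\ h a = cls (f (sval j)))).
  by move=> [i [a Aa ha]]; exists a.
exists (setV (range (g \o k))); rewrite ext_setV_range.
apply/seteqP; split=> _ [z /= Az <-]; first by exists (k z) => //; exact: (kP z).1.
have : inV (h z) w by exact: hw.
rewrite ew => /inV_Node[i hi].
pose j : J := exist _ i (ex_intro2 _ _ z Az hi).
exists j => //=; congr g; apply: h_inj => //; first exact: (kP j).1.
by rewrite (kP j).2.
Qed.

Lemma setV_ex (A : set V) (x : V) : ext x = A -> ext (setV A) = A.
Proof. by move=> e; apply: (@ext_setV x); rewrite e. Qed.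

Lemma small_setV (A : set V) (w : V) : A #<= ext w -> ext (setV A) = A.
Proof. by move=> /(@replacement _ _ id)[x]; rewrite image_id; exact: setV_ex. Qed.

Lemma ext_emptyV : ext emptyV = set0.
Proof. by apply/seteqP; split=> z // /inV_Node[[]]. Qed.

Lemma ext_bigcup (x : V) :
  ext (setV (\bigcup_(y in ext x) ext y)) = \bigcup_(y in ext x) ext y.
Proof.
have [I [f ->]] := clsP x.
have [h hP] : {h : I -> {A : Type & A -> tree} &
    forall i, f i = let: existT A g := h i in Node g}.
  apply: (@choice _ _ (fun i (h : {A : Type & A -> tree}) =>
    f i = let: existT A g := h in Node g)) => i.
  by case: (f i) => A g; exists (existT _ A g).
pose F (p : {i : I & projT1 (h i)}) := projT2 (h (projT1 p)) (projT2 p).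
apply: (@setV_ex _ (cls (Node F))).
have Nh i : f i = Node (projT2 (h i)) by rewrite hP; case: (h i).
apply/seteqP; split=> [z /inV_Node[[i a] ->]|z [_ /inV_Node[i ->]]].
  exists (cls (f i)); first by apply/inV_Node; exists i.
  by rewrite Nh; apply/inV_Node; exists a.
by rewrite Nh => /inV_Node[a ->]; apply/inV_Node; exists (existT _ i a).
Qed.

(** [supV] is defined through [setV], which is meaningful only on sets; the bound [x] makes the
    union a set. *)
Lemma ext_supV (A : set V) (x : V) : A `<=` ext x ->
  ext (supV A) = [set z | exists2 y, A y & inV z y].
Proof.
move=> Ax; rewrite /supV; apply: (@ext_setV (setV (\bigcup_(y in ext x) ext y))).
by rewrite ext_bigcup => z [y Ay zy]; exists y => //; exact: Ax.
Qed.

Lemma inV_irr x : ~ inV x x.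
Proof. by elim/inV_ind: x => x IH xx; exact: (IH _ xx xx). Qed.

Lemma inV_asym x y : inV x y -> ~ inV y x.
Proof. by elim/inV_ind: x y => x IH y xy yx; exact: (IH _ yx _ yx xy). Qed.

Lemma inV_trans a b c : ordinal_set c -> inV a b -> inV b c -> inV a c.
Proof. by move=> [tr _] ab bc; exact: tr _ bc _ ab. Qed.

Lemma inV_acyclic3 x y z : inV x y -> inV y z -> ~ inV z x.
Proof. by elim/inV_ind: x y z => x IH y z xy yz zx; exact: (IH _ zx _ _ zx xy yz). Qed.

Lemma ordinal_inV a b : ordinal_set b -> inV a b -> ordinal_set a.
Proof.
move=> ob ab; have [tr cmp] := ob; split=> [y ya z zy|y z ya za]; last first.
  by apply: cmp; apply: inV_trans ab.
have zb := inV_trans ob zy (inV_trans ob ya ab).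
have [//|za|az] := cmp _ _ zb ab.
  by subst; case: (inV_asym ya).
by case: (inV_acyclic3 az zy).
Qed.

(** Double induction on membership. If neither ordinal is at most a member of the other, the
    induction hypotheses place every member of each in the other, and extensionality applies. *)
Lemma ordinalP a b : ordinal_set a -> ordinal_set b -> [\/ inV a b, a = b | inV b a].
Proof.
elim/inV_ind: a b => a IHa b oa ob.
elim/inV_ind: b ob => b IHb ob.
have [[b' [b'b ab']]|nab] := pselect (exists b', inV b' b /\ ord_le a b').
  by apply: Or31; case: ab' => [ab'|->//]; exact: inV_trans b'b.
have [[a' [a'a ba']]|nba] := pselect (exists a', inV a' a /\ ord_le b a').
  by apply: Or33; case: ba' => [ba'|->//]; exact: inV_trans a'a.
apply: Or32; apply: ext_inj; apply/seteqP; split=> z.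
  move=> za; have [//|zb|bz] := IHa _ za b (ordinal_inV oa za) ob.
    by case: nba; exists z; split=> //; right.
  by case: nba; exists z; split=> //; left.
move=> zb; have [az|az|//] := IHb _ zb (ordinal_inV ob zb).
  by case: nab; exists z; split=> //; left.
by case: nab; exists z; split=> //; right.
Qed.

Lemma ord_leNgt a b : ordinal_set a -> ordinal_set b -> ord_le a b <-> ~ inV b a.
Proof.
move=> oa ob; split=> [[ab|->]|nba]; [exact: inV_asym|exact: inV_irr|].
by have [ab|ab|//] := ordinalP oa ob; [left|right].
Qed.

Lemma ord_le_sub a b : ordinal_set b -> ord_le a b -> ext a `<=` ext b.
Proof. by move=> [tr _] [/tr|->]. Qed.

Lemma sub_ord_le a b : ordinal_set a -> ordinal_set b -> ext a `<=` ext b -> ord_le a b.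
Proof. by move=> oa ob ab; apply/ord_leNgt => // /ab; exact: inV_irr. Qed.

Lemma ord_le_lt_trans a b c : ordinal_set c -> ord_le a b -> inV b c -> inV a c.
Proof. by move=> oc [ab|->//]; exact: inV_trans. Qed.

Lemma ord_lt_le_trans a b c : ordinal_set c -> inV a b -> ord_le b c -> inV a c.
Proof. by move=> oc ab [bc|<-//]; exact: inV_trans bc. Qed.

Lemma ordinal_least (A : set V) : A `<=` ordinal_set -> A !=set0 ->
  exists m, A m /\ forall b, A b -> ord_le m b.
Proof.
move=> Ao [a Aa]; apply: contrapT => no; elim/inV_ind: a Aa => a IH Aa.
apply: no; exists a; split=> // b Ab; apply/ord_leNgt; [exact: Ao..|].
by move=> ba; exact: IH ba Ab.
Qed.

Lemma transitive_ordinal b : transitive_class (ext b) -> ext b `<=` ordinal_set ->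
  ordinal_set b.
Proof. by move=> tr bo; split=> // y z yb zb; apply: ordinalP; exact: bo. Qed.

(** * The cardinals omega_1 and omega_2 *)

Inductive ctree := CLeaf | CNode (f : nat -> ctree).

Fixpoint tree_of_ctree (c : ctree) : tree :=
  if c is CNode f then Node (fun n => tree_of_ctree (f n))
  else Node (fun i : False => match i with end).

(* Countable ordinals are hereditarily countable, so [omega1] is covered by the
   small type [ctree]; this is what makes [omega1] a set. *)
Lemma omega1_set : exists w, ext w = omega1.
Proof.
exists (setV omega1); apply: (@ext_setV (cls (Node tree_of_ctree))) => x.
elim/inV_ind: x => x IH [ox cx]; apply/inV_Node.
have [e|/set0P[y0 xy0]] := eqVneq (ext x) set0.
  by exists CLeaf; apply: ext_inj; rewrite e -ext_emptyV.
have [g [gx g_sur]] := countable_enum xy0 cx.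
have IH' n : exists c, g n = cls (tree_of_ctree c).
  apply/inV_Node; apply: IH; first exact: gx.
  split; first exact: ordinal_inV (gx n).
  by apply: sub_countable cx; apply: subset_card_le; case: ox => + _; apply; exact: gx.
have [f fP] := choice IH'; exists (CNode f); apply: ext_inj.
apply/seteqP; split=> z.
  by move=> /g_sur[n ->]; apply/inV_Node; exists n.
by move=> /inV_Node[n ->]; rewrite -fP; exact: gx.
Qed.

Lemma small_omega1 (A : set V) : A #<= omega1 -> ext (setV A) = A.
Proof. by have [w <-] := omega1_set; exact: small_setV. Qed.

Lemma omega1_ordinal a : omega1 a -> ordinal_set a. Proof. by case. Qed.
Lemma omega2_ordinal a : omega2 a -> ordinal_set a. Proof. by case. Qed.

Lemma omega1_inV a b : omega1 b -> inV a b -> omega1 a.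
Proof.
move=> [ob cb] ab; split; first exact: ordinal_inV ab.
by apply: sub_countable cb; apply: subset_card_le; case: ob => + _; exact.
Qed.

Lemma omega2_inV a b : omega2 b -> inV a b -> omega2 a.
Proof.
move=> [ob cb] ab; split; first exact: ordinal_inV ab.
by apply: card_le_trans cb; apply: subset_card_le; case: ob => + _; exact.
Qed.

(** Burali-Forti: were [omega1] countable, the set with this extension would be a countable ordinal,
    hence its own member. *)
Lemma omega1_uncountable : ~ countable omega1.
Proof.
move=> co; have [w ew] := omega1_set; apply: (@inV_irr w).
have -> : inV w w = ext w w by []. rewrite {1}ew; split; last by rewrite ew.
apply: transitive_ordinal; rewrite ew; last exact: omega1_ordinal.
by move=> y wy z zy; exact: omega1_inV zy.
Qed.

Lemma omega2_large : ~ (omega2 #<= omega1).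
Proof.
move=> co; have ew := small_omega1 co; apply: (@inV_irr (setV omega2)).
have -> : inV (setV omega2) (setV omega2) = ext (setV omega2) (setV omega2) by [].
rewrite {1}ew; split; last by rewrite ew.
apply: transitive_ordinal; rewrite ew; last exact: omega2_ordinal.
by move=> y wy z zy; exact: omega2_inV zy.
Qed.

Lemma countable_le_omega1 T (A : set T) : countable A -> A #<= omega1.
Proof.
move=> cA; have [/(card_le_trans cA)//|/omega1_uncountable//] :=
  card_le_total [set: nat] omega1.
Qed.

Lemma omega1_sub_omega2 : omega1 `<=` omega2.
Proof. by move=> b [ob cb]; split=> //; exact: countable_le_omega1. Qed.


Lemma countableU T (A B : set T) : countable A -> countable B -> countable (A `|` B).
Proof.
move=> cA cB; apply: (@sub_countable _ _ _ (\bigcup_b (if b then A else B))).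
  by apply: subset_card_le => x [?|?]; [exists true|exists false].
by apply: bigcup_countable => // -[].
Qed.

(** * Mostowski collapse and cardinal arithmetic at $\omega_1$ *)

Lemma mostowski T (R : T -> T -> Prop) : well_founded R ->
  (forall x, countable [set y | R y x]) ->
  exists f : T -> V, forall x, ext (f x) = f @` [set y | R y x].
Proof.
move=> wfR cR.
pose G x (rec : forall y, R y x -> V) := setV [set z | exists y (h : R y x), z = rec y h].
pose f := Fix wfR (fun=> V) G; exists f => x.
have -> : f x = setV (f @` [set y | R y x]).
  rewrite /f Fix_eq => [|y g h gh]; last first.
    by congr (G y); apply: functional_extensionality_dep => z; apply/funext => ?; exact: gh.
  congr setV; apply/seteqP; split=> z; first by move=> [y [h ->]]; exists y.
  by move=> [y h <-]; exists y, h.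
apply: small_omega1; apply: card_le_trans (card_image_le _ _) _.
exact: countable_le_omega1.
Qed.

(** The collapse of [R] sends each element of [A] to a countable ordinal, and totality makes it
    injective on [A]. *)
Lemma well_order_le_omega1 T (A : set T) (R : T -> T -> Prop) :
  well_founded R -> (forall x y, R x y -> A x) ->
  (forall x, countable [set y | R y x]) ->
  (forall x y z, R x y -> R y z -> R x z) ->
  (forall x y, A x -> A y -> [\/ R x y, x = y | R y x]) -> A #<= omega1.
Proof.
move=> wfR RA cR trR totR; have [f fE] := mostowski wfR cR.
have fR x y : R x y -> inV (f x) (f y).
  by move=> xy; have : ext (f y) (f x) by rewrite fE; exists x.
have f_tr x : transitive_class (ext (f x)).
  rewrite fE => _ [y yx <-] z; rewrite fE => -[w wy <-].
  by exists w => //=; exact: trR wy yx.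
have f_ord x : ordinal_set (f x).
  split=> [|y z]; first exact: f_tr.
  have fx u : inV u (f x) = (f @` [set y | R y x]) u by rewrite -fE.
  rewrite !fx => -[{}y yx <-] [{}z zx <-].
  have [/fR|->|/fR] := totR _ _ (RA _ _ yx) (RA _ _ zx).
  - exact: Or31.
  - exact: Or32.
  - exact: Or33.
apply: (@inj_on_card_le _ _ _ _ f) => [x Ax|x y Ax Ay e].
  by split=> //; rewrite fE; apply: card_le_trans (card_image_le _ _) (cR _).
by have [/fR|//|/fR] := totR _ _ Ax Ay; rewrite e => /inV_irr.
Qed.

(** [R] is the lexicographic order. The points below [(a, n)] have first coordinate at most [a], so
    there are only countably many. *)
Lemma omega1X_nat : omega1 `*` [set: nat] #<= omega1.
Proof.
pose R (p q : V * nat) := [/\ omega1 p.1, omega1 q.1 &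
  inV p.1 q.1 \/ (p.1 = q.1 /\ (p.2 < q.2)%N)].
apply: (@well_order_le_omega1 _ _ R) => [[a n]|[a n] [b m] []//|[a n]||].
- elim/inV_ind: a n => a IHa n; elim/ltn_ind: n => n IHn.
  constructor=> -[b m] [/= _ _ [/IHa//|[-> /IHn//]]].
- have [oa|na] := pselect (omega1 a); last first.
    by apply: sub_countable (@countable0 (V * nat)); apply: subset_card_le => -[b m] [].
  apply: (@sub_countable _ _ _ ((ext a `|` [set a]) `*` [set: nat])).
    by apply: subset_card_le => -[b m] [/= _ _ [?|[-> _]]]; split=> //; [left|right].
  apply: countableX => //; apply: countableU => //; exact: oa.2.
- move=> [a n] [b m] [c k] [/= oa ob ab] [/= _ oc bc]; split=> //=.
  case: ab bc => [ab|[-> nm]] [bc|[<- mk]]; [left|by left|by left|right].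
    by apply: inV_trans bc => //; case: oc.
  by split=> //; exact: ltn_trans mk.
- move=> [a n] [b m] [/= oa _] [/= ob _].
  have [ab|<-|ba] := ordinalP oa.1 ob.1.
  + by apply: Or31; split=> //; left.
  + case: (ltngtP n m) => [nm|mn|->]; [apply: Or31|apply: Or33|exact: Or32].
      by split=> //; right.
    by split=> //; right.
  + by apply: Or33; split=> //; left.
Qed.

Lemma ext_succ_set (a : V) : omega1 a -> ext (setV (ext a `|` [set a])) = ext a `|` [set a].
Proof.
move=> oa; apply: small_omega1; apply: countable_le_omega1.
by apply: countableU => //; exact: oa.2.
Qed.

Lemma omega1_succ a : omega1 a -> omega1 (setV (ext a `|` [set a])).
Proof.
move=> oa; split; last by rewrite ext_succ_set //; apply: countableU => //; exact: oa.2.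
apply: transitive_ordinal; rewrite ext_succ_set //.
  move=> y [ya|->] z; last by left.
  by move=> zy; left; exact: inV_trans oa.1 zy ya.
by move=> y [|->]; [exact: ordinal_inV oa.1|exact: oa.1].
Qed.

(* A pair of countable ordinals is determined by an upper bound [m] and the
   ranks of its entries in a fixed enumeration of [m]. *)
Lemma omega1X : omega1 `*` omega1 #<= omega1.
Proof.
have [g g_inj] : {g : V -> V -> nat & forall m, omega1 m ->
    forall x y, inV x m -> inV y m -> g m x = g m y -> x = y}.
  apply: (@choice _ _ (fun m h => omega1 m -> forall x y, inV x m -> inV y m ->
    h x = h y -> x = y)) => m.
  have [[_ /card_le_inj_on[h [_ h_inj]]]|nm] := pselect (omega1 m).
    by exists h => _; exact: h_inj.
  by exists (fun=> 0%N).
pose mx (p : V * V) := setV (ext p.1 `|` [set p.1]) .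
have [s sP] : {s : V * V -> V & forall p, (omega1 `*` omega1) p ->
    [/\ omega1 (s p), inV p.1 (s p) & inV p.2 (s p)]}.
  apply: (@choice _ _ (fun p m => (omega1 `*` omega1) p ->
    [/\ omega1 m, inV p.1 m & inV p.2 m])) => -[a b].
  have [[/= oa ob]|] := pselect ((omega1 `*` omega1) (a, b)); last by exists emptyV.
  have aS c : omega1 c -> inV c (setV (ext c `|` [set c])).
    by move=> oc; have := ext_succ_set oc => /seteqP[_]; apply; right.
  have [ab|e|ba] := ordinalP oa.1 ob.1.
  - exists (setV (ext b `|` [set b])) => _; split; [exact: omega1_succ| |exact: aS].
    by have := ext_succ_set ob => /seteqP[_]; apply; left.
  - exists (setV (ext a `|` [set a])) => _; split; [exact: omega1_succ|exact: aS|].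
    by rewrite -e; exact: aS.
  - exists (setV (ext a `|` [set a])) => _; split; [exact: omega1_succ|exact: aS|].
    by have := ext_succ_set oa => /seteqP[_]; apply; left.
apply: card_le_trans omega1X_nat.
apply: (@inj_on_card_le _ _ _ _
  (fun p => (s p, choice.pickle (g (s p) p.1, g (s p) p.2)))) => [p /sP[]//|p q].
move=> /sP[os p1 p2] /sP[_ q1 q2] [e /(pcan_inj choice.pickleK)[e1 e2]].
rewrite [p]surjective_pairing [q]surjective_pairing.
rewrite -e in q1 q2 e1 e2.
by rewrite (g_inj _ os _ _ p1 q1 e1) (g_inj _ os _ _ p2 q2 e2).
Qed.

Lemma card_leX_omega1 T U (A : set T) (B : set U) :
  A #<= omega1 -> B #<= omega1 -> A `*` B #<= omega1.
Proof.
move=> /card_le_inj_on[f [fA f_inj]] /card_le_inj_on[g [gB g_inj]].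
apply: card_le_trans omega1X.
apply: (@inj_on_card_le _ _ _ _ (fun p => (f p.1, g p.2))) => [[x y] [/= Ax By]|].
  by split; [exact: fA|exact: gB].
move=> [x y] [x' y'] [/= Ax By] [/= Ax' By'] [e e'].
by rewrite (f_inj _ _ Ax Ax' e) (g_inj _ _ By By' e').
Qed.

(** An element [x] is coded by the code of a chosen index [k x] together with its own code inside
    [F (k x)]. *)
Lemma card_le_bigcup_omega1 I T (A : set I) (F : I -> set T) :
  A #<= omega1 -> (forall i, A i -> F i #<= omega1) ->
  \bigcup_(i in A) F i #<= omega1.
Proof.
move=> Ale Fle.
have [->|/set0P[x0 [i0 Ai0 _]]] := eqVneq (\bigcup_(i in A) F i) set0; first exact: card_ge0.
have [g gP] : {g : I -> T -> V & forall i, A i -> (forall x, F i x -> omega1 (g i x)) /\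
    (forall x y, F i x -> F i y -> g i x = g i y -> x = y)}.
  apply: (@choice _ _ (fun i h => A i -> (forall x, F i x -> omega1 (h x)) /\
    (forall x y, F i x -> F i y -> h x = h y -> x = y))) => i.
  have [/Fle/card_le_inj_on[h hP]|nA] := pselect (A i); first by exists h.
  by exists (fun=> emptyV).
have [k kP] : {k : T -> I & forall x, (\bigcup_(i in A) F i) x -> A (k x) /\ F (k x) x}.
  apply: (@choice _ _ (fun x i => (\bigcup_(i in A) F i) x -> A i /\ F i x)) => x.
  have [[i Ai Fx]|no] := pselect ((\bigcup_(i in A) F i) x); first by exists i.
  by exists i0.
have [f [fA f_inj]] := card_le_inj_on Ale.
apply: card_le_trans omega1X.
apply: (@inj_on_card_le _ _ _ _ (fun x => (f (k x), g (k x) x))).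
  by move=> x /kP[Ak Fk]; split; [exact: fA|exact: (gP _ Ak).1].
move=> x y /kP[Ak Fk] /kP[Ak' Fk'] [/(f_inj _ _ Ak Ak') e].
by rewrite -e in Fk' * => /((gP _ Ak).2 _ _ Fk Fk').
Qed.

(** A finite set is listed by a sequence, and sequences are coded by iterated pairing. The initial
    value [emptyV] may also be a value of [g], so the length is recorded beside the code. *)
Lemma card_le_finite_omega1 (T : eqType) (A : set T) : A #<= omega1 ->
  [set B | finite_set B /\ B `<=` A] #<= omega1.
Proof.
move=> /[dup] Ale /card_le_inj_on[f [fA f_inj]].
have [g [gA g_inj]] := card_le_inj_on omega1X.
pose P (s : seq T) := forall x, x \in s -> A x.
have w0 : omega1 emptyV.
  by split; rewrite ?ext_emptyV //; apply: transitive_ordinal; rewrite ext_emptyV.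
pose code := foldr (fun x c => g (f x, c)) emptyV.
have codeA s : P s -> omega1 (code s).
  elim: s => [//|x s IH] Ps /=; apply: gA; split=> /=.
    by apply: fA; apply: Ps; rewrite mem_head.
  by apply: IH => y ys; apply: Ps; rewrite in_cons ys orbT.
have code_inj s t : size s = size t -> P s -> P t -> code s = code t -> s = t.
  elim: s t => [|x s IH] [|y t] //= [st] Ps Pt e.
  have Ps' : P s by move=> z zs; apply: Ps; rewrite in_cons zs orbT.
  have Pt' : P t by move=> z zs; apply: Pt; rewrite in_cons zs orbT.
  have Ax : A x by apply: Ps; rewrite mem_head.
  have Ay : A y by apply: Pt; rewrite mem_head.
  have [exy ecode] : (f x, code s) = (f y, code t).
    by apply: g_inj e; split=> /=; by [exact: fA|exact: codeA].
  by rewrite (IH t) // (f_inj _ _ Ax Ay exy).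
have seqs : [set s | P s] #<= omega1.
  apply: card_le_trans omega1X_nat.
  apply: (@inj_on_card_le _ _ _ _ (fun s => (code s, size s))) => [s Ps|s t Ps Pt [e st]].
    by split=> //; exact: codeA.
  exact: code_inj.
apply: card_le_trans seqs.
apply: card_le_trans (card_image_le (fun s => [set x | x \in s]) _).
apply: subset_card_le => B [fB BA].
have [s sB] := (finite_seqP B).1 fB; exists s; last by rewrite sB.
by move=> x xs; apply: BA; rewrite sB.
Qed.

Lemma card_leU_omega1 T (A B : set T) :
  A #<= omega1 -> B #<= omega1 -> A `|` B #<= omega1.
Proof.
move=> cA cB; apply: (@card_le_trans _ _ _ (\bigcup_b (if b then A else B))).
  by apply: subset_card_le => x [?|?]; [exists true|exists false].
by apply: card_le_bigcup_omega1 => [|[]//]; apply: countable_le_omega1.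
Qed.

Lemma card_le_image_omega1 T U (f : T -> U) (A : set T) :
  A #<= omega1 -> f @` A #<= omega1.
Proof. by move=> cA; apply: card_le_trans cA; exact: card_image_le. Qed.

(** * Regularity of $\omega_2$, clubs and cofinality *)

Lemma omega2_bigcup (A : set V) : A `<=` omega2 -> A #<= omega1 ->
  omega2 (setV (\bigcup_(x in A) ext x)) /\
  ext (setV (\bigcup_(x in A) ext x)) = \bigcup_(x in A) ext x.
Proof.
move=> A2 cA; have cU : \bigcup_(x in A) ext x #<= omega1.
  by apply: card_le_bigcup_omega1 => // x /A2[].
have eU := small_omega1 cU; split=> //; split; last by rewrite eU.
apply: transitive_ordinal; rewrite eU.
  by move=> y [x Ax yx] z zy; exists x => //; exact: inV_trans (A2 _ Ax).1 zy yx.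
by move=> y [x Ax yx]; exact: ordinal_inV (A2 _ Ax).1 yx.
Qed.

Lemma omega2_succ a : omega2 a -> exists2 b, omega2 b & ext b = ext a `|` [set a].
Proof.
move=> [oa ca]; have cs : ext a `|` [set a] #<= omega1.
  by apply: card_leU_omega1 => //; exact: countable_le_omega1.
have es := small_omega1 cs; exists (setV (ext a `|` [set a])) => //.
split; last by rewrite es.
apply: transitive_ordinal; rewrite es.
  by move=> y [ya|->] z zy; left => //; exact: inV_trans zy ya.
by move=> y [|->//]; exact: ordinal_inV.
Qed.

Lemma omega2_bounded (A : set V) : A `<=` omega2 -> A #<= omega1 ->
  exists2 d, omega2 d & A `<=` ext d.
Proof.
move=> A2 cA.
(* Successors are used so that the union of the [s a] contains the elements of [A] themselves. *)
have [s sP] : {s : V -> V & forall a, A a -> omega2 (s a) /\ inV a (s a)}.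
  apply: (@choice _ _ (fun a b => A a -> omega2 b /\ inV a b)) => a.
  have [Aa|nA] := pselect (A a); last by exists a.
  have [b ob eb] := omega2_succ (A2 _ Aa); exists b => _; split=> //.
  by have : ext b a by rewrite eb; right.
have [] := @omega2_bigcup (s @` A).
- by move=> _ [a /sP[? _] <-].
- exact: card_le_image_omega1.
move=> oU eU; exists (setV (\bigcup_(x in s @` A) ext x)) => //.
by rewrite eU => a /[dup] Aa /sP[_ ?]; exists (s a) => //; exists a.
Qed.

(** The clause [d <> emptyV] excludes the ordinal 0, which is vacuously closed. For constant [h],
    the closure points then lie above the constant value. *)
Lemma closure_points_club (h : V -> V) : (forall x, omega2 x -> omega2 (h x)) ->
  club_omega2 [set d | [/\ omega2 d, d <> emptyV & forall x, inV x d -> inV (h x) d]].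
Proof.
move=> h2; split=> [d []//|b ob|b ob [b0 eb]].
  have [s sP] : {s : V -> V & forall e, omega2 e ->
      omega2 (s e) /\ ext e `|` [set e] `|` h @` ext e `<=` ext (s e)}.
    apply: (@choice _ _ (fun e s => omega2 e ->
      omega2 s /\ ext e `|` [set e] `|` h @` ext e `<=` ext s)) => e.
    have [oe|] := pselect (omega2 e); last by exists emptyV.
    have [||d od eds] := @omega2_bounded (ext e `|` [set e] `|` h @` ext e).
    - move=> z [[/omega2_inV|->//]|[x /omega2_inV xe <-]]; first exact.
      exact/h2/xe.
    - apply: card_leU_omega1; last by apply: card_le_image_omega1; case: oe.
      by apply: card_leU_omega1; [case: oe|apply: countable_le_omega1].
    by exists d.
  (* The bound [s] is iterated through $\omega$ steps: [h] carries elements of stage [n] into stage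
     [n.+1], so the union of the stages is closed. *)
  pose u n := iter n s b.
  have u2 n : omega2 (u n) by elim: n => //= n /sP[].
  have [] := @omega2_bigcup (range u).
  - by move=> _ [n _ <-].
  - by apply: card_le_image_omega1; apply: countable_le_omega1.
  set d := setV _ => od ed; have bd : inV b d.
    have -> : inV b d = ext d b by []. rewrite ed; exists (u 1%N); first by exists 1%N.
    by apply: (sP _ ob).2; left; right.
  exists d => //; split=> // [d0|x]; first by have : ext emptyV b; [rewrite -d0|rewrite ext_emptyV].
  have dE z : inV z d = ext d z by [].
  rewrite !dE ed => -[_ [n _ <-] xu]; exists (u n.+1); first by exists n.+1.
  by apply: (sP _ (u2 n)).2; right; exists x.
split=> // x xb.
have := @ext_supV ([set d | [/\ omega2 d, d <> emptyV & forall x, inV x d -> inV (h x) d]]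
  `&` ext b) b (@subIsetr _ _ _).
rewrite eb => e; have : ext b x by []. rewrite e => -[d [[od _ hd] db] xd].
exact: inV_trans ob.1 (hd _ xd) db.
Qed.

Lemma stationary_unbounded (S : set V) c : stationary_omega2 S -> omega2 c ->
  exists2 b, S b & inV c b.
Proof.
move=> [_ st] oc; have [b [Sb [ob b0 cb]]] := st _ (closure_points_club (fun _ _ => oc)).
exists b => //; have [z bz] : ext b !=set0.
  by apply/set0P/eqP => e; apply: b0; apply: ext_inj; rewrite e ext_emptyV.
exact: cb bz.
Qed.

(** An unbounded countable subset of [b] would be cofinal, and then [omega1] would inject into
    it. *)
Lemma cof_omega1_bounded b (A : set V) : ordinal_set b -> has_cof b omega1 ->
  A `<=` ext b -> countable A -> exists2 c, inV c b & A `<=` ext c.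
Proof.
move=> ob [_ cof] Ab cA; apply: contrapT => no.
apply: omega1_uncountable; apply: sub_countable cA; apply: cof; split=> // c cb.
apply: contrapT => ncA; apply: no; exists c => // d Ad.
have [//|e|cd] := ordinalP (ordinal_inV ob (Ab _ Ad)) (ordinal_inV ob cb).
  by case: ncA; exists d => //; right.
by case: ncA; exists d => //; left.
Qed.

(** * Comparison points *)

Section Comparison.
Variable Gamma : set V.
Hypothesis Gamma2 : Gamma `<=` omega2.

(** A form free of suprema: a point of [Gamma] below [b] avoids the interval exactly when it is
    below $\sup(M\cap b)$, that is, below some element of $M\cap b$. *)
Lemma Gamma_atP M b : ext M `<=` omega2 -> Gamma_at Gamma M b <->
  Gamma b /\ forall e, Gamma e -> inV e b -> exists x, [/\ inV x M, inV x b & inV e x].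
Proof.
move=> M2; have supE := @ext_supV _ (interV M b) (@subset_refl _ _).
have o_sup : ordinal_set b -> ordinal_set (supV (ext (interV M b))).
  move=> ob; apply: transitive_ordinal; rewrite supE ext_interV.
    move=> y [x [Mx xb] yx] z zy; exists x => //.
    by apply: inV_trans zy yx; case: (M2 _ Mx).
  by move=> y [x [Mx xb] yx]; apply: ordinal_inV yx; case: (M2 _ Mx).
have memE e : inV e (supV (ext (interV M b))) <->
    exists x, [/\ inV x M, inV x b & inV e x].
  have -> : inV e (supV (ext (interV M b))) = ext (supV (ext (interV M b))) e by [].
  rewrite supE ext_interV; split=> [[x [? ?] ?]|[x [? ? ?]]]; first by exists x.
  by exists x.
split=> -[Gb h]; split=> //.
  move=> e Ge eb; apply/memE; apply: contrapT => ne.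
  have : (Gamma `&` itv_co (supV (ext (interV M b))) b) e.
    split=> //; split; first exact: (Gamma2 Ge).1.
    by split=> //; apply/ord_leNgt => //; [apply: o_sup; exact: (Gamma2 Gb).1|exact: (Gamma2 Ge).1].
  by rewrite h.
apply/seteqP; split=> // e [Ge [oe [le eb]]].
have /memE ne := h _ Ge eb.
by have := ord_leNgt (o_sup (Gamma2 Gb).1) oe; move=> [/(_ le)].
Qed.

Lemma Gamma_at_Gamma M b : Gamma_at Gamma M b -> Gamma b. Proof. by case. Qed.

Hypothesis Gamma_unb : forall c, omega2 c -> exists2 b, Gamma b & inV c b.

(* The least upper bound in [Gamma] of the common points is itself a common
   point, since a point of [Gamma] below it would be separated from it by both
   models. *)
Lemma comparison_ptP M N : Pctbl M -> Pctbl N ->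
  let S := Gamma_at Gamma M `&` Gamma_at Gamma N in
  S (comparison_pt Gamma M N) /\ forall c, S c -> ord_le c (comparison_pt Gamma M N).
Proof.
move=> [M2 cM] [N2 cN] S; rewrite /comparison_pt /maxV.
suff [b Sb] : exists b, S b /\ forall c, S c -> ord_le c b.
  exact: (@xgetPex _ emptyV [set b | S b /\ forall c, S c -> ord_le c b]
    (ex_intro _ b Sb)).
have Go : Gamma `<=` ordinal_set by move=> b /Gamma2[].
pose U := [set b | Gamma b /\ forall c, S c -> ord_le c b].
(* Upper bounds exist: no common point can exceed a point of [Gamma] beyond all of [M]. If [S] were
   empty, [b] would be the least element of [Gamma], which is vacuously a common point. *)
have [b [[Gb Ub] bmin]] : exists b, U b /\ forall b', U b' -> ord_le b b'.
  apply: ordinal_least => [b [/Go]//|].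
  have [d od Md] := omega2_bounded M2 (countable_le_omega1 cM).
  have [b Gb db] := Gamma_unb od; exists b; split=> // c [Mc _].
  have [/Gamma2[oc _] Gc] := (Gamma_atP c M2).1 Mc.
  apply/ord_leNgt; [done|exact: Go|] => bc; have [x [Mx _ bx]] := Gc _ Gb bc.
  by apply: (inV_asym bx); apply: inV_trans db; [exact: Go|exact: Md].
exists b; split=> //; apply: contrapT => nSb.
have Sless e : Gamma e -> inV e b -> exists c, [/\ S c, inV e c & inV c b].
  move=> Ge eb; apply: contrapT => no.
  suff /bmin[/(inV_asym eb)//|be] : U e by rewrite be in eb; exact: inV_irr eb.
  split=> // c Sc; apply/ord_leNgt; [exact/Go/(Gamma_at_Gamma Sc.1)|exact: Go|].
  move=> ec; apply: no; exists c; split=> //; have [//|cb] := Ub _ Sc.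
  by case: nSb; rewrite -cb.
have Gat K : ext K `<=` omega2 -> (forall c, S c -> Gamma_at Gamma K c) -> Gamma_at Gamma K b.
  move=> K2 SK; apply/Gamma_atP => //; split=> // e Ge eb.
  have [c [Sc ec cb]] := Sless _ Ge eb.
  have [x [Kx xc ex]] := ((Gamma_atP c K2).1 (SK _ Sc)).2 _ Ge ec.
  by exists x; split=> //; exact: inV_trans (Go _ Gb) xc cb.
by apply: nSb; split; apply: Gat => // c [].
Qed.

End Comparison.

(** * Skolem hulls *)

Lemma card_lt_sub T (A B : set T) (K : set V) : A `<=` B -> card_lt B K -> card_lt A K.
Proof.
move=> AB [BK KB]; have cAB := subset_card_le AB; split; first exact: card_le_trans BK.
by move=> KA; apply: KB; exact: card_le_trans KA cAB.
Qed.

Lemma trcl_transitive x : transitive_class (trcl x).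
Proof. by move=> y yx z zy B [trB xB]; apply: (trB y) => //; exact: yx. Qed.

Lemma trcl_sub x y : ext x `<=` trcl y -> trcl x `<=` trcl y.
Proof. by move=> xy; apply: smallest_sub => //; exact: trcl_transitive. Qed.

Lemma H_omega2_inV x y : H_omega2 x -> inV y x -> H_omega2 y.
Proof.
move=> Hx yx; apply: card_lt_sub Hx; apply: trcl_sub.
by apply: (@trcl_transitive x); exact: sub_gen_smallest.
Qed.

Lemma H_omega2_sub x y : H_omega2 y -> ext x `<=` ext y -> H_omega2 x.
Proof.
move=> Hy xy; apply: card_lt_sub Hy; apply: trcl_sub.
by apply: subset_trans xy _; exact: sub_gen_smallest.
Qed.

Lemma H_omega2_bounded x (A : set V) : transitive_class A -> ext x `<=` A ->
  A #<= omega1 -> H_omega2 x.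
Proof.
move=> trA xA cA; apply: (@card_lt_sub _ _ A); first exact: smallest_sub.
split; first exact: card_le_trans cA (subset_card_le omega1_sub_omega2).
by move=> /card_le_trans/(_ cA)/omega2_large.
Qed.

Lemma omega2_sub_H : omega2 `<=` H_omega2.
Proof. by move=> b [[tr _] cb]; exact: H_omega2_bounded (@subset_refl _ _) cb. Qed.

Lemma Pctbl_H a : Pctbl a -> H_omega2 a.
Proof.
move=> [a2 ca]; have [d [[tr _] cd] ad] := omega2_bounded a2 (countable_le_omega1 ca).
exact: H_omega2_bounded ad cd.
Qed.

(* Formulas extended with implication and universal quantification; [sem] is
   satisfaction with environments given as lists, so that it computes. *)
Inductive fol : nat -> Type :=
| Leq n (i j : 'I_n) : fol n
| Lmem n (i j : 'I_n) : fol n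
| Lpi n (i j : 'I_n) : fol n
| LY n (i : 'I_n) : fol n
| Lnot n (phi : fol n) : fol n
| Land n (phi psi : fol n) : fol n
| Limp n (phi psi : fol n) : fol n
| Lex n (phi : fol n.+1) : fol n
| Lall n (phi : fol n.+1) : fol n.

Fixpoint formula_of n (phi : fol n) : formula n :=
  match phi with
  | Leq _ i j => Feq i j
  | Lmem _ i j => Fmem i j
  | Lpi _ i j => Fpi i j
  | LY _ i => FY i
  | Lnot _ phi => Fnot (formula_of phi)
  | Land _ phi psi => Fand (formula_of phi) (formula_of psi)
  | Limp _ phi psi => Fnot (Fand (formula_of phi) (Fnot (formula_of psi)))
  | Lex _ phi => Fex (formula_of phi)
  | Lall _ phi => Fnot (Fex (Fnot (formula_of phi)))
  end.

Fixpoint sem (pi : V -> V) (Y : set V) n (phi : fol n) : seq V -> Prop :=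
  let v l (i : nat) := nth emptyV l i in
  match phi with
  | Leq _ i j => fun l => v l i = v l j
  | Lmem _ i j => fun l => inV (v l i) (v l j)
  | Lpi _ i j => fun l => omega2 (v l i) /\ pi (v l i) = v l j
  | LY _ i => fun l => Y (v l i)
  | Lnot _ phi => fun l => ~ sem pi Y phi l
  | Land _ phi psi => fun l => sem pi Y phi l /\ sem pi Y psi l
  | Limp _ phi psi => fun l => sem pi Y phi l -> sem pi Y psi l
  | Lex _ phi => fun l => exists2 x, H_omega2 x & sem pi Y phi (x :: l)
  | Lall _ phi => fun l => forall x, H_omega2 x -> sem pi Y phi (x :: l)
  end.

Definition env n (l : seq V) : 'I_n -> V := fun i => nth emptyV l i.

Lemma scons_env n x l : scons x (@env n l) = @env n.+1 (x :: l).
Proof.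
apply/funext => i; rewrite /scons /env.
by case: unliftP => [j ->|->].
Qed.

Lemma sat_env pi Y n (phi : fol n) l :
  sat pi Y (formula_of phi) (@env n l) <-> sem pi Y phi l.
Proof.
elim: phi l => {n} [n i j|n i j|n i j|n i|n phi IH|n phi IH psi IH'|
  n phi IH psi IH'|n phi IH|n phi IH] l //=.
- by split; apply: contra_not => /IH.
- by split=> -[/IH ? /IH' ?].
- split=> [h /IH a|h [/IH a]]; last by apply; apply/IH'; exact: h.
  by apply: contrapT => b; apply: h; split=> // /IH'.
- by split=> -[x Hx]; [rewrite scons_env => /IH|move=> /IH; rewrite -scons_env]; exists x.
- split=> [h x Hx|h [x Hx]]; last by apply; rewrite scons_env; apply/IH; exact: h.
  by apply: contrapT => np; apply: h; exists x => //; rewrite scons_env => /IH.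
Qed.

(** * Formulas for restrictions, index bounds and finite approximations *)

Local Notation v0 := ord0.
Local Notation v1 := (lift ord0 v0).
Local Notation v2 := (lift ord0 v1).
Local Notation v3 := (lift ord0 v2).

(** On [[:: z; P; e]]: [z] is [interV P e]. *)
Definition Linter : fol 3 :=
  Lall (Land (Limp (Lmem v0 v1) (Land (Lmem v0 v2) (Lmem v0 v3)))
             (Limp (Land (Lmem v0 v2) (Lmem v0 v3)) (Lmem v0 v1))).

(** On [[:: e; c]]: [e] is an ordinal below $\omega_2$, expressed by its having a value under [pi],
    and each member of [Y] included in [c] has its index under [pi] in [e]. *)
Definition Lbound : fol 2 :=
  Land (Lex (Lpi v1 v0))
    (Lall (Limp (LY v0) (Limp (Lall (Limp (Lmem v0 v1) (Lmem v0 v3)))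
      (Lex (Land (Lmem v0 v2) (Lpi v0 v1)))))).

Local Notation "i ^+" := (lift ord0 i) (at level 1, format "i ^+").

(* [w] is the least element of [q] properly extending [u], and it extends [u] by
   a single element. *)
Definition Lnext n (w u q : 'I_n) : fol n :=
  Land (Lmem w q) (Land (Lall (Limp (Lmem v0 u^+) (Lmem v0 w^+)))
  (Land (Lex (Land (Lmem v0 w^+) (Lnot (Lmem v0 u^+))))
  (Land (Lall (Lall (Limp (Land (Lmem v0 w^+^+) (Lnot (Lmem v0 u^+^+)))
     (Limp (Land (Lmem v1 w^+^+) (Lnot (Lmem v1 u^+^+))) (Leq v0 v1)))))
  (Lall (Limp (Lmem v0 q^+) (Limp (Lall (Limp (Lmem v0 u^+^+) (Lmem v0 v1)))
     (Limp (Lex (Land (Lmem v0 v1) (Lnot (Lmem v0 u^+^+))))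
       (Lall (Limp (Lmem v0 w^+^+) (Lmem v0 v1)))))))))).

(* On [:: q; P]: every element of [P] belongs to some member of [q] reached from
   the empty set by finitely many steps of [Lnext]. *)
Definition Lchain : fol 2 :=
  Lall (Limp (Lall (Limp (Lmem v0 v2) (Limp (Lall (Lnot (Lmem v0 v1))) (Lmem v0 v1))))
  (Limp (Lall (Lall (Limp (Lmem v1 v2) (Limp (Lnext v0 v1 v3) (Lmem v0 v2)))))
  (Lall (Limp (Lmem v0 v3) (Lex (Land (Lmem v0 v2) (Lmem v1 v0))))))).

Definition next q u w := [/\ inV w q, ext u `<=` ext w,
  exists2 x, inV x w & ~ inV x u,
  forall x y, inV x w -> ~ inV x u -> inV y w -> ~ inV y u -> x = y
  & forall w', inV w' q -> ext u `<=` ext w' -> ~ (ext w' `<=` ext u) ->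
      ext w `<=` ext w'].

(** Members of an element of [H_omega2] are again in [H_omega2], so inclusion is absolute to the
    structure. *)
Lemma H_subP x y : H_omega2 x ->
  (forall z, H_omega2 z -> inV z x -> inV z y) <-> ext x `<=` ext y.
Proof. by move=> Hx; split=> [h z xz|h z _]; [apply: h => //; exact: (H_omega2_inV Hx xz)|exact: h]. Qed.

Lemma H_nsubP x y : H_omega2 x ->
  (exists2 z, H_omega2 z & inV z x /\ ~ inV z y) <-> ~ (ext x `<=` ext y).
Proof.
move=> Hx; split=> [[z _ [xz yz]] xy|]; first exact/yz/xy.
move=> /existsNP[z /not_implyP[xz yz]]; exists z => //; exact: (H_omega2_inV Hx xz).
Qed.

Lemma sem_next pi Y q u w : H_omega2 q -> H_omega2 u -> H_omega2 w ->
  sem pi Y (Lnext v0 v1 v2 : fol 3) [:: w; u; q] <-> next q u w.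
Proof.
move=> Hq Hu Hw /=; rewrite !H_subP //; split.
  move=> [wq [uw [[x _ [xw xu]] [un lst]]]]; split=> //; first by exists x.
    by move=> y z yw yu zw zu; apply: un => //; [exact: (H_omega2_inV Hw zw)|exact: (H_omega2_inV Hw yw)].
  move=> w' w'q uw' w'u; have Hw' := H_omega2_inV Hq w'q.
  by apply/(H_subP _ Hw); apply: lst => //; [exact/(H_subP _ Hu)|exact/(H_nsubP _ Hw')].
move=> [wq uw [x xw xu] un lst]; do !split=> //.
- by exists x => //; exact: (H_omega2_inV Hw xw).
- by move=> y _ z _ [zw zu] [yw yu]; exact: un.
- move=> w' Hw' w'q /(H_subP _ Hu) uw' /(H_nsubP _ Hw') w'u.
  by apply/(H_subP _ Hw); exact: lst.
Qed.

Lemma next_uniq q u w w' : next q u w -> next q u w' -> w = w'.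
Proof.
move=> [wq uw [x xw xu] _ lst] [wq' uw' [x' xw' xu'] _ lst'].
apply: ext_inj; apply/seteqP; split; [apply: lst|apply: lst'] => //.
  by move=> /(_ _ xw').
by move=> /(_ _ xw).
Qed.

(** * Closure properties of Skolem hulls *)

Section Hulls.
Variables (pi : V -> V) (Y : set V) (F : forall n, set (operation n)).
Hypothesis pi_bij : set_bij omega2 H_omega2 pi.
Hypothesis Y_Pctbl : Y `<=` Pctbl.
Hypothesis Y_thin : thin Y.
Hypothesis Y_init : closed_initial Y.
Hypothesis F_skolem : definable_skolem pi Y F.

Lemma sub_Sk A : A `<=` Sk F A. Proof. exact: sub_gen_smallest. Qed.

Lemma Sk_closed A : closed_under F (Sk F A).
Proof.
move=> n f v Ff vA B [cB AB]; apply: (cB n f v Ff) => i.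
by apply: vA.
Qed.

Lemma Sk_H A : A `<=` H_omega2 -> Sk F A `<=` H_omega2.
Proof.
move=> AH; apply: smallest_sub => // n f v Ff Hv.
by have [phi /(_ v Hv)[]] := F_skolem.1 _ _ Ff.
Qed.

(** The Tarski-Vaught property. When the formula has a single solution, that solution lies in the
    hull. *)
Lemma Sk_ex A n (phi : fol n.+1) l : A `<=` H_omega2 -> size l = n ->
  (forall x, x \in l -> Sk F A x) -> (exists2 x, H_omega2 x & sem pi Y phi (x :: l)) ->
  exists2 x, Sk F A x & sem pi Y phi (x :: l).
Proof.
move=> AH sl lA ex; have [f Ff sk] := F_skolem.2 _ (formula_of phi).
have vA : tuple_in (Sk F A) (@env n l).
  by move=> i; apply: lA; rewrite mem_nth // sl.
exists (f (@env n l)); first exact: Sk_closed.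
apply/sat_env; rewrite -scons_env; apply: sk; first by move=> i; exact: (Sk_H AH (vA i)).
by case: ex => x Hx /sat_env; rewrite -scons_env; exists x.
Qed.

Lemma Sk_interV A P e : A `<=` H_omega2 -> Sk F A P -> Sk F A e -> Sk F A (interV P e).
Proof.
move=> AH AP Ae; have HP := Sk_H AH AP.
have HI : H_omega2 (interV P e) by apply: (H_omega2_sub HP); rewrite ext_interV; exact: subIsetl.
have [|||z Az /= zP] := @Sk_ex A 2 Linter [:: P; e] AH.
- by [].
- by move=> x; rewrite !inE => /orP[]/eqP->.
- exists (interV P e) => //= t _.
  have -> : inV t (interV P e) = (ext P `&` ext e) t by rewrite -ext_interV.
  by split=> -[].
suff -> : interV P e = z by [].
apply: ext_inj; rewrite ext_interV; apply/seteqP; split=> t.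
  by move=> [tP te]; apply: (zP t (H_omega2_inV HP tP)).2.
by move=> tz; apply: (zP t (H_omega2_inV (Sk_H AH Az) tz)).1.
Qed.

Lemma Sk_pi A e : A `<=` H_omega2 -> omega2 e -> Sk F A e <-> Sk F A (pi e).
Proof.
move=> AH oe; have [/= piH pi_inj _] := pi_bij; split=> Ae.
  have [|||z Az /= [_ -> //]] := @Sk_ex A 1 (Lpi v1 v0) [:: e] AH; first by [].
    by move=> x; rewrite mem_seq1 => /eqP ->.
  by exists (pi e); [exact: piH|].
have [|||z Az /= [oz ez]] := @Sk_ex A 1 (Lpi v0 v1) [:: pi e] AH; first by [].
- by move=> x; rewrite mem_seq1 => /eqP ->.
- by exists e; [exact: omega2_sub_H|].
by rewrite -(pi_inj z e) // inE.
Qed.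

(** By thinness at most $\omega_1$ members of [Y] are included in [c], so their indices are bounded
    below $\omega_2$; [Lbound] defines such bounds from [c]. *)
Lemma Sk_bound A c : A `<=` H_omega2 -> Sk F A c -> omega2 c ->
  exists e, [/\ Sk F A e, omega2 e & forall a, Y a -> ext a `<=` ext c ->
    exists2 d, inV d e & omega2 d /\ pi d = a].
Proof.
move=> AH Ac oc; have [/= piH pi_inj pi_sur] := pi_bij.
have [|||e Ae /= [[y _ [oe _]] h]] := @Sk_ex A 1 Lbound [:: c] AH; first by [].
- by move=> x; rewrite mem_seq1 => /eqP ->.
- have [||e oe Xe] := @omega2_bounded
    [set d | omega2 d /\ exists2 a, Y a & ext a `<=` ext c /\ pi d = a].
  + by move=> d [].
  + apply: card_le_trans (Y_thin oc).
    apply: (@inj_on_card_le _ _ _ _ pi) => [d [_ [a Ya [ac ->]]]|d d' [od _] [od' _]].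
      by exists a => //; apply: ext_inj; rewrite ext_interV; exact/setIidPl.
    by move=> /pi_inj; apply; rewrite inE.
  exists e; first exact: omega2_sub_H.
  split=> /=; first by exists (pi e) => //; exact: piH.
  move=> a Ha Ya /(H_subP _ Ha) ac; have [d od da] := pi_sur _ Ha.
  exists d; first exact: omega2_sub_H.
  by split=> //; apply: Xe; split=> //; exists a.
exists e; split=> // a Ya ac; have Ha := Pctbl_H (Y_Pctbl Ya).
have [|d _ [de dpi]] := h a Ha Ya; first exact/H_subP.
by exists d.
Qed.

(* A countable [P] is the union of an increasing sequence [q] of finite sets,
   each obtained from the previous one by adding one element; that [q] is such a
   sequence is expressed in the structure by induction over subsets of [q]. *)
Lemma Sk_countable A P : A `<=` H_omega2 -> Sk F A P -> Pctbl P -> ext P `<=` Sk F A.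
Proof.
move=> AH AP [P2 cP].
have [->//|/set0P[p0 Pp0]] := eqVneq (ext P) set0.
have [g [gP g_sur]] := countable_enum Pp0 cP.
pose Q n := setV (g @` `I_n).
have QE n : ext (Q n) = g @` `I_n.
  by apply: small_omega1; apply: card_le_image_omega1; apply: countable_le_omega1.
pose q0 := setV (range Q).
have q0E : ext q0 = range Q.
  by apply: small_omega1; apply: card_le_image_omega1; apply: countable_le_omega1.
have HP := Sk_H AH AP.
have Hq0 : H_omega2 q0.
  have [d od Pd] := omega2_bounded P2 (countable_le_omega1 cP).
  apply: (@H_omega2_bounded _ (range Q `|` ext d)).
  - move=> y [[n _ <-]|yd]; last by move=> z zy; right; exact: inV_trans od.1 zy yd.
    by rewrite QE => z [k _ <-]; right; apply: Pd.
  - by rewrite q0E => z; left.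
  - apply: card_leU_omega1; last by case: od.
    by apply: card_le_image_omega1; apply: countable_le_omega1.
have HQ n : H_omega2 (Q n) by apply: (H_omega2_inV Hq0); rewrite -[inV _ _]/(ext q0 _) q0E; exists n.
have Qmono m n : (m <= n)%N -> ext (Q m) `<=` ext (Q n).
  by move=> mn; rewrite !QE => _ [k km <-]; exists k => //=; exact: leq_trans mn.
(* The enumeration [g] may repeat values, in which case [Q n.+1] equals [Q n]; a step of [next]
   occurs only when [g n] is new. *)
have Q_next n : ~ inV (g n) (Q n) -> next q0 (Q n) (Q n.+1).
  move=> gn; have QS x : inV x (Q n.+1) -> ~ inV x (Q n) -> x = g n.
    rewrite -![inV _ _]/(ext _ _) !QE => -[k /= kn <-]; rewrite ltnS leq_eqVlt in kn.
    by case/orP: kn => [/eqP->//|kn] []; exists k.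
  have gQ : inV (g n) (Q n.+1) by rewrite -[inV _ _]/(ext _ _) QE; exists n => /=.
  split=> //.
  - by rewrite -[inV _ _]/(ext _ _) q0E; exists n.+1.
  - exact: Qmono.
  - by exists (g n).
  - by move=> x y /QS h /h-> /QS h' /h'->.
  - move=> w'; rewrite -[inV _ _]/(ext _ _) q0E => -[m _ <-] _ nm; apply: (Qmono).
    by rewrite ltnNge; apply/negP => mn; apply: nm; exact: Qmono.
have [|||q Aq /= qP] := @Sk_ex A 1 Lchain [:: P] AH; first by [].
- by move=> x; rewrite mem_seq1 => /eqP ->.
- exists q0 => //= s Hs s0 sS p Hp Pp.
  have Qs n : inV (Q n) s.
    elim: n => [|n IH].
      apply: s0 => //; first by rewrite -[inV _ _]/(ext _ _) q0E; exists 0%N.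
      by move=> x _; rewrite -[inV _ _]/(ext _ _) QE => -[].
    have [gn|gn] := pselect (inV (g n) (Q n)); last first.
      by apply: (sS (Q n) (HQ _) (Q n.+1) (HQ _) IH);
        apply/(sem_next pi Y Hq0 (HQ _) (HQ _)); exact: Q_next.
    suff -> : Q n.+1 = Q n by [].
    apply: ext_inj; apply/seteqP; split; last exact: Qmono.
    rewrite QE => _ [k /= kn <-]; rewrite ltnS leq_eqVlt in kn.
    by case/orP: kn => [/eqP->//|kn]; rewrite QE; exists k.
  have [n pn] := g_sur _ Pp; exists (Q n.+1) => //; split; first exact: Qs.
  by rewrite -[inV _ _]/(ext _ _) QE; exists n => //=.
have Hq := Sk_H AH Aq.
(* The hull supplies some [q] satisfying [Lchain], perhaps other than [q0]. The set [s] may lie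
   outside the hull, but it is in [H_omega2], so the induction expressed by [Lchain] applies to
   it. *)
pose s := setV (ext q `&` [set u | Sk F A u /\ ext u `<=` Sk F A]).
have sE : ext s = ext q `&` [set u | Sk F A u /\ ext u `<=` Sk F A].
  by apply: (@ext_setV q); exact: subIsetl.
have sP u : inV u s <-> [/\ inV u q, Sk F A u & ext u `<=` Sk F A].
  by rewrite -[inV u s]/(ext s u) sE; split=> [[? []]|[]].
have Hs : H_omega2 s by apply: (H_omega2_sub Hq); rewrite sE; exact: subIsetl.
move=> p Pp; have [||u _ [us pu]] := qP s Hs _ _ p (H_omega2_inV HP Pp) Pp.
- move=> u Hu uq u0; apply/sP; split=> //.
    have [|||u' Au' /= u'0] := @Sk_ex A 0 (Lall (Lnot (Lmem v0 v1))) [::] AH => //.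
      by exists u.
    suff -> : u = u' by [].
    apply: ext_inj; apply/seteqP; split=> z zu.
      by case: (u0 z) => //; exact: (H_omega2_inV Hu zu).
    by case: (u'0 z) => //; exact: (H_omega2_inV (Sk_H AH Au') zu).
  by move=> z zu; case: (u0 z) => //; exact: H_omega2_inV zu.
- move=> u Hu w Hw /sP[uq Au uA] /(sem_next pi Y Hq Hu Hw) nw.
  (* The successor of [u] in [q] is unique, hence definable from [u] and [q]; below, its only new
     element is likewise definable from [w] and [u]. *)
  have Aw : Sk F A w.
    have [|||w' Aw' w'P] := @Sk_ex A 2 (Lnext v0 v1 v2) [:: u; q] AH; first by [].
    - by move=> x; rewrite !inE => /orP[]/eqP->.
    - by exists w => //; exact/sem_next.
    suff -> : w = w' by [].
    by apply: next_uniq nw _; apply/(sem_next pi Y Hq Hu (Sk_H AH Aw')).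
  have [wq uw [x xw xu] un _] := nw; apply/sP; split=> // y yw.
  have [yu|yu] := pselect (inV y u); first exact: uA.
  have [|||z Az /= [zw zu]] :=
      @Sk_ex A 2 (Land (Lmem v0 v1) (Lnot (Lmem v0 v2))) [:: w; u] AH; first by [].
  - by move=> t; rewrite !inE => /orP[]/eqP->.
  - by exists y => //; exact: (H_omega2_inV Hw yw).
  by rewrite (un y z).
by have /sP[_ _] := us; apply.
Qed.

End Hulls.

(** * Amalgamation of conditions *)

Lemma interV_interV M b c : ordinal_set c -> ord_le b c ->
  interV (interV M c) b = interV M b.
Proof.
move=> oc bc; apply: ext_inj; rewrite !ext_interV -setIA; congr (_ `&` _).
by apply/setIidPr; exact: ord_le_sub.
Qed.

Lemma interVC_sub M b c : ordinal_set b -> inV c b -> ext M `&` ext b `<=` ext c ->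
  interV M b = interV M c.
Proof.
move=> ob cb Mbc; apply: ext_inj; rewrite !ext_interV; apply/seteqP; split=> x [Mx xb].
  by split=> //; exact: Mbc.
by split=> //; exact: inV_trans ob xb cb.
Qed.

Lemma ext_interVP x M b : inV x (interV M b) <-> inV x M /\ inV x b.
Proof. by rewrite -[inV x (interV M b)]/(ext (interV M b) x) ext_interV. Qed.

Definition comparable F Gamma M N :=
  let b := comparison_pt Gamma M N in
  [\/ interV M b = interV N b,
      Sk F (ext N) (interV M b)
    | Sk F (ext M) (interV N b)].

Lemma comparableC F Gamma M N : comparable F Gamma M N -> comparable F Gamma N M.
Proof.
rewrite /comparable /= {1 2 3 4}/comparison_pt setIC => -[->|?|?].
- exact: Or31.
- exact: Or33.
- exact: Or32.
Qed.

(** Only the first coordinate of each triple is recorded, since in a condition the other two lie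
    below it. *)
Definition support (p : precond) : set V :=
  p.1.1 `|` [set t.1.1 | t in p.1.2] `|` \bigcup_(M in p.2) ext M.

(* The flag records whether the model reaches beyond [d]; without it, clause (5)
   could fail for the union of two conditions with the same trace. *)
Definition trace (d : V) (p : precond) : set V * set (V * V * V) * set (V * bool) :=
  (p.1.1 `&` ext d, p.1.2 `&` [set t | inV t.1.1 d],
   [set (interV M d, `[< exists z, inV z M /\ ~ inV z d >]) | M in p.2]).

Definition traces (Y : set V) (c : V) :=
  [set t : set V * set (V * V * V) * set (V * bool) |
    [/\ finite_set t.1.1 /\ t.1.1 `<=` ext c,
        finite_set t.1.2 /\ t.1.2 `<=` ext c `*` ext c `*` ext c
      & finite_set t.2 /\ t.2 `<=` [set interV a c | a in Y] `*` setT]].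

Definition unionC (p q : precond) : precond :=
  (p.1.1 `|` q.1.1, p.1.2 `|` q.1.2, p.2 `|` q.2).

Section Amalgamation.
Variables (pi : V -> V) (Y : set V) (F : forall n, set (operation n)) (Gamma : set V).
Hypothesis pi_bij : set_bij omega2 H_omega2 pi.
Hypothesis Y_Pctbl : Y `<=` Pctbl.
Hypothesis Y_thin : thin Y.
Hypothesis Y_init : closed_initial Y.
Hypothesis F_skolem : definable_skolem pi Y F.
Hypothesis Gamma_sub : Gamma `<=` Lambda F.
Hypothesis Gamma_stat : stationary_omega2 Gamma.

Let Gamma2 : Gamma `<=` omega2 := Gamma_stat.1.
Let Gamma_unb c : omega2 c -> exists2 b, Gamma b & inV c b.
Proof. exact: stationary_unbounded. Qed.
Let Gamma_ord : Gamma `<=` ordinal_set.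
Proof. by move=> b /Gamma2[]. Qed.

Let X_Pctbl M : Xset Y F M -> Pctbl M.
Proof. by move=> [/Y_Pctbl]. Qed.

Let X_sub_omega2 M : Xset Y F M -> ext M `<=` omega2.
Proof. by move=> /X_Pctbl[]. Qed.

Let X_sub_H M : Xset Y F M -> ext M `<=` H_omega2.
Proof. by move=> /X_sub_omega2 M2 x /M2/omega2_sub_H. Qed.

(** The countable set [a] is bounded by some [c] below [b], and some [d] in [Cset F] lies between
    [c] and [b]. The hull of [d] contains a bound for the indices of the members of [Y] included in
    [c], and this bound is below [d]. *)
Lemma index_below_Lambda b a : Lambda F b -> Y a -> ext a `<=` ext b ->
  exists d, [/\ inV d b, omega2 d & pi d = a].
Proof.
move=> [ob cofb [_ supb]] Ya ab.
have [c cb ac] := cof_omega1_bounded ob.1 cofb ab (Y_Pctbl Ya).2.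
have := @ext_supV (Cset F `&` ext b) b (@subIsetr _ _ _); rewrite supb => eb.
have : ext b c by []. rewrite eb => -[d [[od Cd] db] cd].
have dH : ext d `<=` H_omega2 by move=> x /(omega2_inV od)/omega2_sub_H.
have [e [Se oe eP]] := Sk_bound pi_bij Y_Pctbl Y_thin F_skolem dH (@sub_Sk F (ext d) c cd)
  (omega2_inV ob cb).
have ed : inV e d by rewrite -[inV e d]/(ext d e) -Cd.
have [i ie [oi ia]] := eP _ Ya ac; exists i; split=> //.
exact: inV_trans ob.1 (inV_trans od.1 ie ed) db.
Qed.

(** The ordinal [b] may lie outside [K]. As [P] is included in [K], cutting at [b] amounts to
    cutting at the least element of [K] not below [b], or to no cut if there is none. *)
Lemma Sk_restrict K P b : Xset Y F K -> Pctbl P -> Sk F (ext K) P -> ordinal_set b ->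
  Sk F (ext K) (interV P b).
Proof.
move=> XK PP SP ob; have [_ KE _] := XK.
have PK : ext P `<=` ext K.
  move=> x Px; rewrite -KE; split; last exact: PP.1.
  exact: (Sk_countable F_skolem (X_sub_H XK) SP PP).
have [[x [Kx xb]]|Kb] := pselect (exists x, inV x K /\ ~ inV x b); last first.
  suff -> : interV P b = P by [].
  apply: ext_inj; rewrite ext_interV; apply/setIidPl => x /PK Kx.
  by apply: contrapT => xb; apply: Kb; exists x.
have Ko y : inV y K -> ordinal_set y by move=> /(X_sub_omega2 XK)[].
have [e [[Ke eb] emin]] := @ordinal_least [set x | inV x K /\ ~ inV x b]
  (fun y Ky => Ko y Ky.1) (ex_intro _ x (conj Kx xb)).
suff -> : interV P b = interV P e.
  exact: (Sk_interV F_skolem (X_sub_H XK) SP (@sub_Sk F (ext K) e Ke)).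
apply: ext_inj; rewrite !ext_interV; apply/seteqP; split=> y [Py yb]; split=> //.
  have [//|ye|ey] := ordinalP (Ko _ (PK _ Py)) (Ko _ Ke); case: eb.
    by rewrite -ye.
  exact: inV_trans ob ey yb.
apply: contrapT => nyb; have [ey|ey] := emin y (conj (PK _ Py) nyb).
  exact: inV_asym ey yb.
by rewrite ey in yb; exact: inV_irr yb.
Qed.

(** The index of [P] is in [K] and below [b], where [K] and [N] agree; [P] is then recovered from it
    by [pi]. *)
Lemma Sk_transfer K N P b : Xset Y F K -> Xset Y F N -> Lambda F b ->
  interV K b = interV N b -> Y P -> ext P `<=` ext b ->
  Sk F (ext K) P -> Sk F (ext N) P.
Proof.
move=> XK XN Lb KN YP Pb SP; have [d [db od dP]] := index_below_Lambda Lb YP Pb.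
rewrite -dP in SP *; have [_ KE _] := XK.
have Kd : inV d K.
  rewrite -[inV d K]/(ext K d) -KE; split=> //.
  by apply/(Sk_pi pi_bij F_skolem (X_sub_H XK) od).
have /ext_interVP[Nd _] : inV d (interV N b) by rewrite -KN; apply/ext_interVP.
by apply/(Sk_pi pi_bij F_skolem (X_sub_H XN) od); exact: sub_Sk.
Qed.

Lemma comparable_trace d d' K M N :
  Gamma d -> Gamma d' -> inV d d' ->
  Xset Y F K -> Xset Y F M -> Xset Y F N ->
  ext M `<=` ext d' -> interV K d = interV N d' ->
  comparable F Gamma M K -> comparable F Gamma M N.
Proof.
move=> Gd Gd' dd' XK XM XN Md' KN.
have KNP x : inV x K /\ inV x d <-> inV x N /\ inV x d'.
  by rewrite -!ext_interVP KN.
have [PK PM PN] := And3 (X_Pctbl XK) (X_Pctbl XM) (X_Pctbl XN).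
have [[SMb SNb] _] := comparison_ptP Gamma2 Gamma_unb PM PN.
have [_ max_b0] := comparison_ptP Gamma2 Gamma_unb PM PK.
have [[/Gamma_ord ob0 _] _] := (comparison_ptP Gamma2 Gamma_unb PM PK).1.
rewrite /comparable /=.
set b := comparison_pt Gamma M N in SMb SNb *.
set b0 := comparison_pt Gamma M K in max_b0 ob0 *.
have [Gb Mb] := (Gamma_atP Gamma2 b (X_sub_omega2 XM)).1 SMb.
have [_ Nb] := (Gamma_atP Gamma2 b (X_sub_omega2 XN)).1 SNb.
have [od od' ob] := And3 (Gamma_ord Gd) (Gamma_ord Gd') (Gamma_ord Gb).
have bd' : ord_le b d'.
  apply/ord_leNgt => // d'b; have [x [Mx _ d'x]] := Mb _ Gd' d'b.
  exact: inV_asym d'x (Md' _ Mx).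
(* Otherwise [d], a point of [Gamma] below [b], would require an element of [N] between [d] and [b];
   but the elements of [N] below [d'] are all below [d]. *)
have bd : ord_le b d.
  apply/ord_leNgt => // db; have [x [Nx xb dx]] := Nb _ Gd db.
  have [_ xd] := (KNP x).2 (conj Nx (ord_lt_le_trans od' xb bd')).
  exact: inV_asym dx xd.
have KNb : interV K b = interV N b.
  apply: ext_inj; rewrite !ext_interV; apply/seteqP; split=> x [xK xb]; split=> //.
    by have [] := (KNP x).1 (conj xK (ord_lt_le_trans od xb bd)).
  by have [] := (KNP x).2 (conj xK (ord_lt_le_trans od' xb bd')).
have bb0 : ord_le b b0.
  apply: max_b0; split=> //; apply/(Gamma_atP Gamma2 b (X_sub_omega2 XK)).
  split=> // e Ge eb; have [x [Nx xb ex]] := Nb _ Ge eb; exists x; split=> //.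
  have /ext_interVP[] // : inV x (interV K b) by rewrite KNb; apply/ext_interVP.
have Pctbl_interV P c : Pctbl P -> Pctbl (interV P c).
  move=> [P2 cP]; rewrite /Pctbl /= ext_interV; split=> [x [/P2]//|].
  by apply: sub_countable cP; apply: subset_card_le; exact: subIsetl.
(* Each case is cut from [b0] down to [b]. Only the second also needs a transfer from [K] to [N]; in
   the third, [K] and [N] agree below [b]. *)
case=> [eq|SK|SM].
- by apply: Or31; rewrite -(interV_interV M ob0 bb0) eq interV_interV.
- apply: Or32; apply: (Sk_transfer XK XN (Gamma_sub Gb) KNb).
  + by apply: Y_init; [case: XM|exact: Gamma2].
  + by rewrite ext_interV; exact: subIsetr.
  + by rewrite -(interV_interV M ob0 bb0); apply: Sk_restrict => //; exact: Pctbl_interV.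
- apply: Or33; rewrite -KNb -(interV_interV K ob0 bb0).
  by apply: Sk_restrict => //; exact: Pctbl_interV.
Qed.

(** Only clauses mixing [p] and [q] need an argument: an item of [q] relevant below [d'] is
    exchanged for its counterpart in [p], given by the common trace. *)
Lemma unionC_condition c d d' p q :
  Gamma d -> Gamma d' -> inV d d' -> inV c d ->
  condition Y F Gamma p -> condition Y F Gamma q ->
  trace d p = trace d' q ->
  support p `<=` ext d' -> support q `&` ext d' `<=` ext c ->
  condition Y F Gamma (unionC p q).
Proof.
move=> Gd Gd' dd' cd.
have [od od'] := conj (Gamma_ord Gd) (Gamma_ord Gd').
have oc := ordinal_inV od cd.
case: p => [[a x] A]; case: q => [[a' x'] A'].
move=> [[fa aP] [fx xP] [fA [AX Acmp]] x_disj [A5 A6]].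
move=> [[fa' aP'] [fx' xP'] [fA' [AX' Acmp']] x_disj' [A5' A6']].
move=> [ea ex eA] pd' qc.
have a_sub xi : a xi -> inV xi d' by move=> axi; apply: pd'; left; left.
have x_sub al g b : x (al, g, b) -> inV al d'.
  by move=> xt; apply: pd'; left; right; exists (al, g, b).
have A_sub M : A M -> ext M `<=` ext d' by move=> AM z Mz; apply: pd'; right; exists M.
have A'_sub M : A' M -> ext M `&` ext d' `<=` ext c.
  by move=> AM z [Mz zd]; apply: qc; split=> //; right; exists M.
have a_eq xi : a xi /\ inV xi d <-> a' xi /\ inV xi d'.
  by change ((a `&` ext d) xi <-> (a' `&` ext d') xi); rewrite ea.
have x_eq t : x t /\ inV t.1.1 d <-> x' t /\ inV t.1.1 d'.
  by change ((x `&` [set t | inV t.1.1 d]) t <-> (x' `&` [set t | inV t.1.1 d']) t); rewrite ex.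
have A_eq N : A' N -> exists K, [/\ A K, interV K d = interV N d' &
    (exists z, inV z N /\ ~ inV z d') -> exists z, inV z K /\ ~ inV z d].
  move=> A'N; have : [set (interV M d', `[< exists z, inV z M /\ ~ inV z d' >]) | M in A']
    (interV N d', `[< exists z, inV z N /\ ~ inV z d' >]) by exists N.
  rewrite -eA => -[K AK [eKN efl]]; exists K; split=> // h.
  by apply/asboolP; rewrite efl; apply/asboolP.
split.
- by rewrite finite_setU; split=> // z [/aP|/aP'].
- rewrite finite_setU; split=> // al g b [/xP|/xP'] //.
- rewrite finite_setU; split=> //; split=> [M [/AX|/AX']//|M N].
  have mix M' N' : A M' -> A' N' -> comparable F Gamma M' N'.
    move=> AM AN; have [K [AK eK _]] := A_eq _ AN.
    apply: (comparable_trace Gd Gd' dd' (AX _ AK) (AX _ AM) (AX' _ AN)) => //.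
    + exact: A_sub.
    + exact: Acmp.
  move=> [AM|AM] [AN|AN]; [exact: Acmp|exact: mix| |exact: Acmp'].
  by apply: comparableC; exact: mix.
(* A triple of [q] sharing its first coordinate with one of [p] has that coordinate below [d'], so
   it belongs to [p] as well. *)
- have mix al g b g' b' : x (al, g, b) -> x' (al, g', b') ->
      (al, g, b) <> (al, g', b') -> itv_co g b `&` itv_co g' b' = set0.
    move=> xt xt'; apply: x_disj => //.
    by have [] := (x_eq (al, g', b')).2 (conj xt' (x_sub _ _ _ xt)).
  move=> al g b g' b' [xt|xt] [xt'|xt'] ne.
  + exact: x_disj ne.
  + exact: mix ne.
  + by rewrite setIC; apply: mix xt' xt _ => e; apply: ne; rewrite e.
  + exact: x_disj' ne.
split.
- move=> xi M [axi|axi] [AM|AM] sup_xi Mxi.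
  + exact: (A5 xi M).
  + have [K [AK eK fK]] := A_eq _ AM.
    have oxi : ordinal_set xi by case: (aP _ axi) => -[].
    have xid' := a_sub _ axi.
    (* [xi] is the supremum of elements of [M] below [d']; these are below [c], so [xi] is at most
       [c]. *)
    have xid : inV xi d.
      apply: ord_le_lt_trans od _ cd; apply: sub_ord_le => //.
      have := ext_supV (@subset_refl _ (ext (interV M xi))); rewrite sup_xi ext_interV => ->.
      move=> z [y [My yxi] zy]; apply: inV_trans oc zy _.
      by apply: (A'_sub _ AM); split=> //; exact: inV_trans od' yxi xid'.
    have eKxi : interV K xi = interV M xi.
      rewrite -(interV_interV K od (or_introl xid)) eK interV_interV //; by left.
    have /ext_interVP[] // : inV xi (interV M d').
    rewrite -eK; apply/ext_interVP; split=> //.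
    apply: (A5 xi K) => //; first by rewrite eKxi.
    (* [K] must reach beyond [xi]. A witness from [M] below [d'] is shared with [K]; one beyond [d']
       is turned by the flag into an element of [K] beyond [d]. *)
    have [z [Mz zxi]] := Mxi; have [zd'|zd'] := pselect (inV z d').
      have /ext_interVP[Kz _] : inV z (interV K d) by rewrite eK; apply/ext_interVP.
      by exists z.
    have [|w [Kw wd]] := fK; first by exists z.
    by exists w; split=> // wxi; apply: wd; exact: inV_trans od wxi xid.
  + have oxi : ordinal_set xi by case: (aP' _ axi) => -[].
    have [xid'|nxid'] := pselect (inV xi d').
      by apply: (A5 xi M) => //; have [] := (a_eq xi).2 (conj axi xid').
    case: Mxi => z [Mz]; case; apply: (ord_lt_le_trans oxi (A_sub _ AM _ Mz)).
    exact/ord_leNgt.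
  + exact: (A5' xi M).
- move=> M al g b [AM|AM] Mal [xt|xt].
  + exact: (A6 M al g b).
  + apply: (A6 M al g b) => //.
    by have [] := (x_eq (al, g, b)).2 (conj xt (A_sub _ AM _ Mal)).
  + have [K [AK eK _]] := A_eq _ AM.
    have ald' := x_sub _ _ _ xt.
    have [Kal ald] : inV al K /\ inV al d.
      by apply/ext_interVP; rewrite eK; apply/ext_interVP.
    (* Clause (6) at [al] concerns a model only below [al], which is below [d] and [d'], so it
       passes from [K] to [M]. *)
    have [Gal gb bal] := xP _ _ _ xt.
    have below z : ord_le z b -> inV z K <-> inV z M.
      move=> zb; have zal := ord_le_lt_trans (Gamma_ord Gal) zb bal.
      have zd := inV_trans od zal ald; have zd' := inV_trans od' zal ald'.
      split=> [zK|zM].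
        by have /ext_interVP[] : inV z (interV M d') by rewrite -eK; apply/ext_interVP.
      by have /ext_interVP[] : inV z (interV K d) by rewrite eK; apply/ext_interVP.
    have -> : ext M `&` itv_cc g b = ext K `&` itv_cc g b.
      by apply/seteqP; split=> z [zM [oz [gz zb]]]; split=> //; apply/below.
    have -> : interV M al = interV K al.
      by rewrite -(interV_interV K od (or_introl ald)) eK interV_interV //; left.
    have [A61 A62] := A6 K al g b AK Kal xt; split=> // /A61[gK bK].
    by split; apply/below => //; [left|right].
  + exact: (A6' M al g b).
Qed.

Lemma card_le_traces c : omega2 c -> traces Y c #<= omega1.
Proof.
move=> oc; have cc : ext c #<= omega1 by case: oc.
have c1 := card_le_finite_omega1 cc.
have c2 := card_le_finite_omega1 (card_leX_omega1 (card_leX_omega1 cc cc) cc).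
have c3 := card_le_finite_omega1 (card_leX_omega1 (Y_thin oc)
  (countable_le_omega1 (countableP [set: bool]))).
apply: card_le_trans (card_leX_omega1 (card_leX_omega1 c1 c2) c3).
by apply: subset_card_le => t [].
Qed.

Lemma support_countable p : condition Y F Gamma p ->
  support p `<=` omega2 /\ countable (support p).
Proof.
case: p => [[a x] A] [[fa aP] [fx xP] [fA [AX _]] _ _]; split.
  move=> z [[/= /aP[]//|[[[al g] b] /= /xP[/Gamma2 ? _ _] <-]//]|[M /AX/X_sub_omega2 M2 /M2]//].
apply: countableU; first apply: countableU => /=.
- exact: finite_set_countable.
- by apply: finite_set_countable; exact: finite_image.
- by apply: bigcup_countable => [|M /AX/X_Pctbl[]//]; exact: finite_set_countable.
Qed.

Lemma trace_bounded p c d : Gamma d -> inV c d -> condition Y F Gamma p ->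
  support p `&` ext d `<=` ext c ->
  traces Y c (trace d p).
Proof.
move=> Gd cd; have od := Gamma_ord Gd; have oc := ordinal_inV od cd.
case: p => [[a x] A] [[fa aP] [fx xP] [fA [AX _]] _ _] pc /=; split; split.
- by apply: sub_finite_set fa; exact: subIsetl.
- by move=> z [az zd]; apply: pc; split=> //; left; left.
- by apply: sub_finite_set fx; exact: subIsetl.
- move=> [[al g] b] [/= xt ald]; have alc : inV al c.
    by apply: pc; split=> //; left; right; exists (al, g, b).
  have [_ gb bal] := xP _ _ _ xt; have bc := inV_trans oc bal alc.
  by split=> //; split=> //; exact: inV_trans gb bc.
- exact: finite_image.
- move=> _ [M AM <-]; split=> //=; exists M; first by case: (AX _ AM).
  apply/esym/interVC_sub => // z [Mz zd]; apply: pc; split=> //.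
  by right; exists M.
Qed.

End Amalgamation.

(** * Finding two compatible conditions among $\omega_2$ many *)

Theorem proposition6p3
  (pi : V -> V) (Y : set V) (F : forall n : nat, set (operation n))
  (Gamma : set V)
  (card_hyp : [set A : set V | A `<=` omega1] #= omega2)
  (pi_bij : set_bij omega2 H_omega2 pi)
  (Y_stat : stationary_Pctbl Y)
  (Y_thin : thin Y)
  (Y_init : closed_initial Y)
  (F_skolem : definable_skolem pi Y F)
  (Gamma_sub : Gamma `<=` Lambda F)
  (Gamma_stat : stationary_omega2 Gamma) :
  chain_condition (condition Y F Gamma) condition_le omega2.
Proof.
move=> W [WP W_anti]; have Y_Pctbl := Y_stat.1.
suff small : ~ (omega2 #<= W).
  by split=> //; have [|/small] := card_le_total W omega2.
move=> /card_le_inj_on[f [fW f_inj]].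
have fP d : omega2 d -> condition Y F Gamma (f d) by move=> /fW/WP.
pose good c t d := [/\ Gamma d, inV c d & trace d (f d) = t].
(* [e c t] selects one index in [Gamma] above [c] with trace [t], whenever there is any. *)
have [e eP] : {e : V -> _ -> V & forall c t, (exists d, good c t d) -> good c t (e c t)}.
  apply: (@choice _ _ (fun c e => forall t, (exists d, good c t d) -> good c t (e t))) => c.
  have [e eP] : {e & forall t, (exists d, good c t d) -> good c t (e t)}.
    apply: (@choice _ _ (fun t d => (exists d, good c t d) -> good c t d)) => t.
    have [[d ?]|no] := pselect (exists d, good c t d); first by exists d.
    by exists emptyV.
  by exists e.
(* A point closed under [h] lies above the supports of all earlier conditions and above the indices
   selected for earlier [c]; the latter are at most $\omega_1$ many for each [c]. *)
have [h hP] : {h : V -> V & forall c, omega2 c -> omega2 (h c) /\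
    (support (f c) `|` e c @` (traces Y c `&` [set t | exists d, good c t d]) `<=` ext (h c))}.
  apply: (@choice _ _ (fun c h => omega2 c -> omega2 h /\
    (support (f c) `|` e c @` (traces Y c `&` [set t | exists d, good c t d]) `<=` ext h))) => c.
  have [oc|] := pselect (omega2 c); last by exists emptyV.
  have [s2 sc] := support_countable Y_Pctbl Gamma_stat (fP _ oc).
  have [||b ob bP] := @omega2_bounded
      (support (f c) `|` e c @` (traces Y c `&` [set t | exists d, good c t d])).
  - move=> z [/s2//|[t [_ /(eP c)[Gd _ _]] <-]]; exact: Gamma_stat.1.
  - apply: card_leU_omega1; first exact: countable_le_omega1.
    apply: card_le_image_omega1; apply: card_le_trans (card_le_traces Y_thin oc).
    by apply: subset_card_le; exact: subIsetl.
  by exists b.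
have [d' [Gd' [od' _ hd']]] := Gamma_stat.2 _ (closure_points_club (fun c oc => (hP c oc).1)).
have [_ sc] := support_countable Y_Pctbl Gamma_stat (fP _ od').
have [_ cofd' _] := Gamma_sub _ Gd'.
have [c cd' cP] := @cof_omega1_bounded d' (support (f d') `&` ext d') od'.1 cofd'
  (@subIsetr _ _ _) (sub_countable (subset_card_le (@subIsetl _ _ _)) sc).
have oc := omega2_inV od' cd'.
(* [d'] itself realizes its trace, so the selection for [c] returns an index [d] with the same
   trace; it is below [d'] because it is below [h c]. *)
have gd' : exists d, good c (trace d' (f d')) d by exists d'.
have [Gd cd ed] := eP _ _ gd'; set d := e c _ in Gd cd ed.
have dd' : inV d d'.
  apply: inV_trans od'.1 _ (hd' _ cd'); apply: (hP c oc).2; right.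
  exists (trace d' (f d')) => //; split=> //.
  exact: (trace_bounded Gamma_stat Gd' cd' (fP _ od') cP).
have od := Gamma_stat.1 _ Gd.
have sd : support (f d) `<=` ext d'.
  move=> z sz; apply: inV_trans od'.1 _ (hd' _ dd'); apply: (hP d od).2; by left.
apply: (W_anti (f d) (f d')); [exact: fW|exact: fW| |].
  by move=> /(f_inj _ _ od od') e'; move: dd'; rewrite e'; exact: inV_irr.
exists (unionC (f d) (f d')); split.
- exact: (unionC_condition pi_bij Y_Pctbl Y_thin Y_init F_skolem Gamma_sub Gamma_stat
    Gd Gd' dd' cd (fP _ od) (fP _ od') ed sd cP).
- by case: (f d) => [[? ?] ?]; case: (f d') => [[? ?] ?]; split=> z; left.
- by case: (f d) => [[? ?] ?]; case: (f d') => [[? ?] ?]; split=> z; right.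
Qed.
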